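(* Suppose that $\alpha=0$ and $h=0$. With $m_*(J)$, $\Psi_c(J)$ and the cones $\Lambda_{t,0}(J)$ defined in the context: (i) $J\mapsto m_*(J)$ is strictly increasing on $(\frac32,\infty)$. (ii) $J\mapsto\Psi_c(J)$ is strictly decreasing on $(1,\infty)$. (iii) $J\mapsto\Lambda_{t,0}(J)$ is left-continuous at $J=\frac32$ for all $t>\Psi_c(\frac32)$. (iv) $J\mapsto\Lambda_{\Psi_c(\bar J),0}(J)$ is right-continuous at $J=\bar J$ for all $\bar J>\frac32$. (v) For every $J\le\frac32$ the map $t\mapsto\Lambda_{t,0}(J)$ is continuous. (vi) For every $J>\frac32$ the map $t\mapsto\Lambda_{t,0}(J)$ is continuous except at $t=\Psi_c(J)$, where it exhibits a right-continuous jump.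
   Context: Let $J>0$. Rate functions (for $h=0$): $I_S(m)=-\frac12Jm^2+\frac{1+m}{2}\log(1+m)+\frac{1-m}{2}\log(1-m)$ on $[-1,+1]$ (with $0\log0=0$). For a càdlàg path $\phi:[0,t]\to[-1,+1]$ let $I^t(\phi)=I_S(\phi(0))+\int_0^tL(\phi(s),\dot\phi(s))\,ds$ if $\dot\phi$ exists (i.e. $\phi$ is absolutely continuous) and $I^t(\phi)=\infty$ otherwise, where $$L(m,\dot m)=-\tfrac12\sqrt{4(1-m^2)+\dot m^2}+\tfrac12\dot m\log\Big(\frac{\sqrt{4(1-m^2)+\dot m^2}+\dot m}{2(1-m)}\Big)+1$$ (extended by lower semicontinuity to $m=\pm1$). For $m\in[-1,+1]$, $C_{t,0}(m)=\inf\{I^t(\phi):\phi(0)=m,\ \phi(t)=0\}$, and $\Delta_{t,0}$ is the set of global minimizers of $C_{t,0}$, a set symmetric under $m\mapsto-m$. Critical time: let $a^J(m)=\sinh(2Jm)-m\cosh(2Jm)$, $t(m)=\frac12\operatorname{arccoth}\big(a^J(m)/m\big)$ and $C_M(m)=\frac12Jm^2+\frac12\log[1-m\tanh(Jm)]$. For $1<J\le\frac32$, $\Psi_c(J)=\frac12\operatorname{arccoth}(2J-1)$. For $J>\frac32$, $\Psi_c(J)=t(m_* )$, where $m_*=m_*(J)\in(0,1)$ is the positive solution of $C_M(m_* )=0$. Cones: for $t>0$ let $\hat m(t)=\max\Delta_{t,0}\ge0$ and let $\hat\phi_{t,0}(s)=\hat m(t)\,\frac{\sinh(2(t-s))}{\sinh(2t)}$,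 $0\le s\le t$, be the corresponding minimizing trajectory. $\Lambda_{t,0}(J)$ is the cone between the trajectories $\pm\hat\phi_{t,0}$, i.e. $\Lambda_{t,0}(J)=\{(s,x):0\le s\le t,\ |x|\le\hat\phi_{t,0}(s)\}$ (a segment if $\hat m(t)=0$). Continuity of set-valued maps is with respect to the Hausdorff distance between compact subsets of $\mathbb{R}^2$. *)

(* Defs.v *)
From HB Require Import structures.
From mathcomp Require Import all_boot all_order all_algebra.
From mathcomp Require Import all_classical all_reals all_analysis.

Set Implicit Arguments.
Unset Strict Implicit.
Unset Printing Implicit Defensive.

Import Order.TTheory GRing.Theory Num.Theory.
Import numFieldNormedType.Exports.

Local Open Scope classical_set_scope.
Local Open Scope ring_scope.

(* All rate functions are those of the zero-field model (h = 0). *)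

Definition sinh {R : realType} (x : R) : R := (expR x - expR (- x)) / 2.
Definition cosh {R : realType} (x : R) : R := (expR x + expR (- x)) / 2.
Definition tanh {R : realType} (x : R) : R := sinh x / cosh x.

(* Meaningful for 1 < `|x|. *)
Definition arccoth {R : realType} (x : R) : R := ln ((x + 1) / (x - 1)) / 2.

(* The convention 0 log 0 = 0 holds at m = 1 and m = -1 because ln 0 = 0. *)
Definition I_S {R : realType} (J m : R) : R :=
  - (J * m ^+ 2 / 2) + (1 + m) / 2 * ln (1 + m) + (1 - m) / 2 * ln (1 - m).

Definition lagrangian_int {R : realType} (m v : R) : R :=
  - (Num.sqrt (4 * (1 - m ^+ 2) + v ^+ 2) / 2)
  + v / 2 * ln ((Num.sqrt (4 * (1 - m ^+ 2) + v ^+ 2) + v) / (2 * (1 - m)))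
  + 1.

(* At m = 1 and m = -1: the lower semicontinuous extension, that is the lower
   limit, jointly in both variables, of the values at interior points.  It can
   be +oo there. *)
Definition lagrangian {R : realType} (m v : R) : \bar R :=
  if `|m| < 1 then (lagrangian_int m v)%:E
  else limf_einf (fun p : R * R => (lagrangian_int p.1 p.2)%:E)
         (within [set p : R * R | `|p.1| < 1] (nbhs (m, v))).

Definition absolutely_continuous {R : realType} (a b : R) (f : R -> R) : Prop :=
  forall e : R, 0 < e -> exists2 d : R, 0 < d &
    forall (n : nat) (u v : 'I_n -> R),
      (forall i, a <= u i /\ u i <= v i /\ v i <= b) ->
      trivIset [set: 'I_n] (fun i => [set` `]u i, v i[]) ->
      \sum_(i < n) (v i - u i) < d ->
      \sum_(i < n) `|f (v i) - f (u i)| < e.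

Definition cadlag {R : realType} (t : R) (phi : R -> R) : Prop :=
  (forall s, 0 <= s < t -> phi x @[x --> s^'+] --> phi s) /\
  (forall s, 0 < s <= t -> cvg (phi x @[x --> s^'-])).

(* A path on [0, t] is a total function of which only the restriction to [0, t]
   is constrained. *)
Definition paths {R : realType} (t : R) : set (R -> R) :=
  [set phi | cadlag t phi /\ forall s, 0 <= s <= t -> -1 <= phi s <= 1].

(* For absolutely continuous phi the derivative exists almost everywhere on
   [0, t]; the arbitrary value of derive1 phi elsewhere does not affect the
   integral. *)
Definition action {R : realType} (J t : R) (phi : R -> R) : \bar R :=
  if `[< absolutely_continuous 0 t phi >] then
    ((I_S J (phi 0))%:E
     + \int[lebesgue_measure]_(s in `[0%R, t]) lagrangian (phi s) (derive1 phi s))%E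
  else +oo%E.

Definition cost {R : realType} (J t alpha m : R) : \bar R :=
  ereal_inf (action J t @` [set phi | paths t phi /\ phi 0 = m /\ phi t = alpha]).

Definition minimizers {R : realType} (J t alpha : R) : set R :=
  [set m | -1 <= m <= 1 /\
     forall m', -1 <= m' <= 1 -> (cost J t alpha m <= cost J t alpha m')%E].

Definition a_J {R : realType} (J m : R) : R :=
  sinh (2 * J * m) - m * cosh (2 * J * m).

Definition time_of {R : realType} (J m : R) : R := arccoth (a_J J m / m) / 2.

Definition C_M {R : realType} (J m : R) : R :=
  J * m ^+ 2 / 2 + ln (1 - m * tanh (J * m)) / 2.

(* Used for 3/2 < J, where the solution exists and is unique. *)
Definition m_star {R : realType} (J : R) : R :=
  xget 0 [set m | 0 < m < 1 /\ C_M J m = 0].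

(* Used for 1 < J. *)
Definition Psi_c {R : realType} (J : R) : R :=
  if J <= 3 / 2 then arccoth (2 * J - 1) / 2 else time_of J (m_star J).

Definition m_hat {R : realType} (J t : R) : R :=
  xget 0 [set m | minimizers J t 0 m /\ ubound (minimizers J t 0) m].

Definition phi_hat {R : realType} (J t s : R) : R :=
  m_hat J t * (sinh (2 * (t - s)) / sinh (2 * t)).

Definition cone {R : realType} (J t : R) : set (R * R) :=
  [set p | 0 <= p.1 <= t /\ `|p.2| <= phi_hat J t p.1].

Definition euclidean_dist {R : realType} (p q : R * R) : R :=
  Num.sqrt ((p.1 - q.1) ^+ 2 + (p.2 - q.2) ^+ 2).

Definition dist_to {R : realType} (A : set (R * R)) (p : R * R) : R :=
  inf (euclidean_dist p @` A).

(* Meaningful for nonempty bounded sets; a metric on nonempty compact sets. *)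
Definition hausdorff_dist {R : realType} (A B : set (R * R)) : R :=
  Num.max (sup (dist_to B @` A)) (sup (dist_to A @` B)).

(* Main.v *)
Require Import Defs.
From HB Require Import structures.
From mathcomp Require Import all_boot all_order all_algebra.
From mathcomp Require Import all_classical all_reals all_analysis.
From mathcomp Require Import ring lra.
Set Implicit Arguments.
Unset Strict Implicit.
Unset Printing Implicit Defensive.
Import Order.TTheory GRing.Theory Num.Theory.
Import numFieldNormedType.Exports.
Local Open Scope classical_set_scope.
Local Open Scope ring_scope.

(** The dynamical part. For z in (-1, 1) put e(s) = exp (- 2 (t - s)). The function
    S(s, m) = - dual_value (t - s) z m is affine in m and solves the
    Hamilton-Jacobi equation dS/ds + H(m, dS/dm) = 0 for the Hamiltonian
    H(m, p) = cosh 2p - 1 - m sinh 2p of spins that flip independently at rate 1,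
    whose Legendre transform is the Lagrangian. Hence L(phi, phi') dominates the
    derivative of s |-> S(s, phi s) along every absolutely continuous path
    ([cost_ge_dual_value]), with equality along the path
    phi(s) = sinh (2 (t - s)) * 2z / (1 - z^2) ([cost_le_dual_value]). As the
    start of this path sweeps (-1, 1) with z, this gives the cost of every
    |m| < 1 in closed form ([cost_eq_min_cost]) and a lower bound at m = 1, -1. Passing from
    the derivative to its integral needs that an absolutely continuous function
    is differentiable almost everywhere and is the integral of its derivative
    ([ac_derivative]): such a function is the difference of two nondecreasing
    ones, whose Stieltjes measures are dominated by Lebesgue measure, so that the
    Radon-Nikodym and Lebesgue differentiation theorems apply.

    The static part. The slope in m > 0 of the cost has the sign of
    coth 2t - k_J(m), where k_J(m) = a^J(m) / m ([slope_sign]), and at a zero of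
    the slope the cost is C_M(m) ([min_cost_critical]). Repeated differentiation shows
    that k_J, once it has stopped increasing, decreases for ever
    ([coth_time_unimodal]); for J <= 3/2 it decreases from the start, beginning at
    2J - 1. Hence the minimizers are 0 and, up to sign, the point m where k_J
    crosses coth 2t for the last time, and the sign of C_M(m) decides between
    them ([m_hat_cross], [m_hat_eq0]). Since the slope of C_M has the sign of
    k_J', C_M has on (0, 1) the single zero m_star when J > 3/2, it lies on the
    decreasing branch of k_J, and Psi_c is exactly the last time at which 0 is a
    minimizer.

    The conclusions. The cost of m <> 0 decreases strictly in J, so that 0 ceases to be
    a minimizer earlier for larger J, which is (ii); (i) holds because C_M increases
    in J as long as tanh (J m) > m, which C_M >= 0 forces. The cones depend
    continuously on the half-width m_hat and on t ([hausdorff_cone_cvg]), so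
    (iii)-(vi) are statements about m_hat, which follows the decreasing branch of
    the inverse of k_J except for the jump from 0 to m_star at Psi_c. *)

(** * Absolutely continuous functions of the line *)

(** Only innermost conditionals are split: [lra] cannot use a comparison of
    terms that still contain one. *)
Ltac case_min_max := rewrite ?/Order.max ?/Order.min;
  repeat match goal with
  |- context [if (?a < ?b)%O then _ else _] =>
     lazymatch constr:((a, b)) with
     | context [if _ then _ else _] => fail
     | _ => have [? | ?] := ltP a b
     end
  end.

Section AC.
Context {R : realType}.
Implicit Types f : R -> R.
Notation mu := (@lebesgue_measure R).

(** Pairwise disjointness of the open intervals ]u i, v i[, stated on points, so
    that it survives any shrinking of the intervals. Degenerate intervals are
    allowed. *)
Definition disjoint_itvs (I : finType) (u v : I -> R) : Prop :=
  (forall i, u i <= v i) /\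
  (forall i j x, u i < x < v i -> u j < x < v j -> i = j).

Lemma sum_reindex_ord (I : finType) (F : I -> R) :
  \sum_i F i = \sum_(k < #|I|) F (enum_val k).
Proof. by rewrite (reindex _ (onW_bij _ (enum_val_bij I))). Qed.

Lemma disjoint_itvs_ord (I : finType) (u v : I -> R) :
  disjoint_itvs u v ->
  disjoint_itvs (fun k : 'I_#|I| => u (enum_val k)) (fun k => v (enum_val k)).
Proof.
move=> [uv dis]; split=> [k|k l x hk hl]; first exact: uv.
by apply: enum_val_inj; exact: dis hk hl.
Qed.

Lemma disjoint_itvs_triv (I : finType) (u v : I -> R) :
  disjoint_itvs u v -> trivIset [set: I] (fun i => [set` `]u i, v i[]).
Proof.
move=> [_ dis]; apply/trivIsetP => i j _ _ ij; apply/seteqP; split => // x /= [].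
by rewrite !in_itv/= => h1 h2; move/eqP: ij; apply; exact: dis h1 h2.
Qed.

(** The lengths add up to the Lebesgue measure of the union. *)
Lemma disjoint_itvs_length (I : finType) (u v : I -> R) (a b : R) :
  disjoint_itvs u v -> (forall i, a <= u i /\ v i <= b) -> a <= b ->
  \sum_i (v i - u i) <= b - a.
Proof.
move=> dis ab leab; rewrite sum_reindex_ord.
move: (disjoint_itvs_ord dis) => {}dis.
set u' := (fun k => u (enum_val k)) in dis.
set v' := (fun k => v (enum_val k)) in dis.
have {}ab k : a <= u' k /\ v' k <= b by exact: ab.
have [uv _] := dis.
rewrite -lee_fin -sumEFin.
rewrite (eq_bigr (fun i => mu `]u' i, v' i[)); last first.
  move=> i _; rewrite lebesgue_measure_itv/= lte_fin.
  have [//|vu] := ltP (u' i) (v' i).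
  have -> : v (enum_val i) = u (enum_val i); last by rewrite subrr.
  by apply/le_anti; rewrite vu uv.
rewrite -measure_bigsetU_ord//=; last exact: disjoint_itvs_triv.
have -> : ((b - a)%:E = mu `[a, b])%E.
  rewrite lebesgue_measure_itv/= lte_fin; case: ltgtP leab => // ->.
  by rewrite subrr.
apply: le_measure; rewrite ?inE//.
- exact: bigsetU_measurable.
- move=> x; rewrite -bigcup_seq => -[i _] /=; rewrite !in_itv/= => /andP[h1 h2].
  by have [h3 h4] := ab i; rewrite (le_trans h3 (ltW h1)) (le_trans (ltW h2) h4).
Qed.

(** Index types are arbitrary finite types, so that families can be merged and
    refined with sum and sigma types; there is no interval of reference,
    functions on [a, b] being extended by constants. *)
Definition globally_ac f : Prop :=
  forall e : R, 0 < e -> exists2 d : R, 0 < d &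
    forall (I : finType) (u v : I -> R), disjoint_itvs u v ->
      \sum_i (v i - u i) < d -> \sum_i `|f (v i) - f (u i)| < e.

Definition clamp (a b x : R) : R := Num.max a (Num.min x b).

Lemma clamp_le a b x y : x <= y -> clamp a b x <= clamp a b y.
Proof. by move=> xy; rewrite /clamp; case_min_max; lra. Qed.

Lemma clamp_sub a b x y : x <= y -> clamp a b y - clamp a b x <= y - x.
Proof. by move=> xy; rewrite /clamp; case_min_max; lra. Qed.

Lemma clamp_itv a b x : a <= b -> a <= clamp a b x <= b.
Proof. by rewrite /clamp; case_min_max; lra. Qed.

Lemma clamp_id a b x : a <= x <= b -> clamp a b x = x.
Proof. by rewrite /clamp; case_min_max; lra. Qed.

Lemma clamp_oo a b u v x : a <= b ->
  clamp a b u < x < clamp a b v -> u < x < v.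
Proof. by rewrite /clamp; case_min_max; lra. Qed.

Lemma disjoint_itvs_clamp (I : finType) (u v : I -> R) (a b : R) : a <= b ->
  disjoint_itvs u v ->
  disjoint_itvs (fun i => clamp a b (u i)) (fun i => clamp a b (v i)).
Proof.
move=> ab [uv dis]; split=> [i|i j x hi hj]; first exact: clamp_le.
by apply: (dis i j x); exact: (clamp_oo ab).
Qed.

Lemma ac_globally a b f : a <= b ->
  absolutely_continuous a b f -> globally_ac (f \o clamp a b).
Proof.
move=> ab acf e e0; have [d d0 H] := acf e e0; exists d => // I u v dis dlt.
have dis' := disjoint_itvs_ord (disjoint_itvs_clamp ab dis).
rewrite sum_reindex_ord; apply: (H _ _ _ _ (disjoint_itvs_triv dis')).
- move=> i; split; first by have /andP[] := clamp_itv (u (enum_val i)) ab.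
  by split; [exact: dis'.1|have /andP[] := clamp_itv (v (enum_val i)) ab].
- apply: le_lt_trans dlt; rewrite [leRHS]sum_reindex_ord.
  by apply: ler_sum => i _; apply: clamp_sub; exact: dis.1.
Qed.

Lemma globally_acB f g : globally_ac f -> globally_ac g -> globally_ac (f \- g).
Proof.
move=> acf acg e e0; have e20 : 0 < e / 2 by lra.
have [d1 d10 H1] := acf _ e20; have [d2 d20 H2] := acg _ e20.
exists (Num.min d1 d2); first by rewrite lt_min d10.
move=> I u v dis; rewrite lt_min => /andP[s1 s2].
rewrite [ltRHS]splitr; apply: le_lt_trans (ltrD (H1 _ _ _ dis s1) (H2 _ _ _ dis s2)).
rewrite -big_split/=; apply: ler_sum => i _.
apply: le_trans (ler_normB _ _); rewrite le_eqVlt; apply/orP; left; apply/eqP.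
by congr (`| _ |); lra.
Qed.

Lemma globally_ac_continuous f : globally_ac f -> continuous f.
Proof.
move=> acf x; apply/cvgrPdist_lt => e e0; have [d d0 H] := acf e e0.
near=> y.
have xy : `|x - y| < d by near: y; apply: cvgr_dist_lt => //; exact: cvg_id.
have := H 'I_1 (fun=> Num.min x y) (fun=> Num.max x y).
rewrite !big_ord1; have [xley|/ltW ylex] := leP x y.
- rewrite distrC; apply.
  + by split=> // i j; rewrite !ord1.
  + by rewrite -(ger0_norm (_ : 0 <= y - x)) ?subr_ge0// distrC.
- apply.
  + by split=> // i j; rewrite !ord1.
  + by rewrite -(ger0_norm (_ : 0 <= x - y)) ?subr_ge0.
Unshelve. all: by end_near. Qed.

Definition var_sums f (x : R) : set R :=
  [set r | exists (I : finType) (u v : I -> R),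
     [/\ disjoint_itvs u v, forall i, v i <= x & r = \sum_i (f (v i) - f (u i))]].

Definition pos_var f (x : R) : R := sup (var_sums f x).

Definition bounded_var f := exists N : R, forall (I : finType) (u v : I -> R),
  disjoint_itvs u v -> \sum_i (f (v i) - f (u i)) <= N.

(** Cutting an interval at x into its parts below and above x; each part may be
    degenerate. *)
Lemma split_clamp (f : R -> R) (u v x : R) :  u <= v ->
  f v - f u = (f (Num.min v x) - f (Num.min u x))
            + (f (Num.max v x) - f (Num.max u x)).
Proof. by move=> uv; case_min_max; lra. Qed.

Lemma disjoint_itvs_min (I : finType) (u v : I -> R) (x : R) :
  disjoint_itvs u v ->
  disjoint_itvs (fun i => Num.min (u i) x) (fun i => Num.min (v i) x).
Proof.
move=> [uv dis]; split=> [i|i j y hi hj].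
  by have := uv i; case_min_max; lra.
by apply: (dis i j y); [move: hi {hj}; have := uv i|move: hj {hi}; have := uv j];
  case_min_max; lra.
Qed.

Lemma disjoint_itvs_max (I : finType) (u v : I -> R) (x : R) :
  disjoint_itvs u v ->
  disjoint_itvs (fun i => Num.max (u i) x) (fun i => Num.max (v i) x).
Proof.
move=> [uv dis]; split=> [i|i j y hi hj].
  by have := uv i; case_min_max; lra.
by apply: (dis i j y); [move: hi {hj}; have := uv i|move: hj {hi}; have := uv j];
  case_min_max; lra.
Qed.

(** Cut [a, b] into pieces shorter than the modulus of f for the error 1: every
    piece contributes at most 1. *)
Lemma ac_bounded_var a b f : a <= b -> globally_ac f ->
  (forall x, f (clamp a b x) = f x) -> bounded_var f.
Proof.
move=> ab acf fcl; have [d d0 H] := acf 1 ltr01.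
(* d / 2 and not d: the total length must be strictly below the modulus. *)
have step (k : nat) (I : finType) (u v : I -> R) : disjoint_itvs u v ->
    (forall i, a <= u i /\ v i <= a + k%:R * (d / 2)) ->
    \sum_i (f (v i) - f (u i)) <= k%:R.
  elim: k I u v => [|k IH] I u v dis uvk.
    rewrite big1// => i _; have [h1 h2] := uvk i; have h3 := dis.1 i.
    by have -> : v i = u i; [lra|rewrite subrr].
  pose x := a + k%:R * (d / 2).
  rewrite (eq_bigr _ (fun i _ => split_clamp f x (dis.1 i))) big_split/=.
  rewrite -[in leRHS]natr1 lerD//.
  - apply: IH; first exact: disjoint_itvs_min.
    move=> i; split; last by rewrite ge_min lexx orbT.
    rewrite le_min (uvk i).1/= /x lerDl; apply: mulr_ge0 => //; lra.
  - apply: le_trans (_ : \sum_i `|f (Num.max (v i) x) - f (Num.max (u i) x)| <= _).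
      by apply: ler_sum => i _; exact: ler_norm.
    apply: ltW; apply: (H _ _ _ (disjoint_itvs_max x dis)).
    apply: le_lt_trans (_ : _ <= (x + d / 2) - x) _; last by lra.
    apply: (disjoint_itvs_length (disjoint_itvs_max x dis)); last by lra.
    move=> i; split; first by rewrite le_max lexx orbT.
    have [_ h] := uvk i; rewrite ge_max; apply/andP; split; last by lra.
    by move: h; rewrite /x -natr1; lra.
have [k hk] : exists k : nat, b <= a + k%:R * (d / 2).
  exists (Num.trunc ((b - a) / (d / 2))).+1.
  rewrite -lerBlDl -ler_pdivrMr; last by lra.
  by apply/ltW/truncnS_gt.
exists k%:R => I u v dis.
rewrite (eq_bigr (fun i => f (clamp a b (v i)) - f (clamp a b (u i)))); last first.
  by move=> i _; rewrite !fcl.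
apply: step; first exact: disjoint_itvs_clamp.
move=> i; have /andP[h1 _] := clamp_itv (u i) ab; have /andP[_ h2] := clamp_itv (v i) ab.
by split => //; apply: le_trans hk.
Qed.

End AC.

(** * The positive variation of an absolutely continuous function *)

Section posvar.
Context {R : realType}.
Context (f : R -> R) (bvf : bounded_var f).

Lemma var_sums0 x : var_sums f x 0.
Proof.
exists 'I_0, (fun=> x), (fun=> x); split; last by rewrite big_ord0.
- by split=> //; case.
- by case.
Qed.

Lemma has_sup_var_sums x : has_sup (var_sums f x).
Proof.
split; first by exists 0; exact: var_sums0.
by have [N HN] := bvf; exists N => _ [I [u [v [dis _ ->]]]]; exact: HN.
Qed.

Lemma le_pos_var x y : x <= y -> pos_var f x <= pos_var f y.
Proof.
move=> xy; apply: ge_sup; first by exists 0; exact: var_sums0.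
move=> _ [I [u [v [dis vx ->]]]]; apply: (sup_upper_bound (has_sup_var_sums y)).
by exists I, u, v; split => // i; exact: le_trans xy.
Qed.

(** An admissible family for x can be completed by the interval ]x, y[. Hence
    pos_var f - f is nondecreasing. *)
Lemma pos_var_increment x y : x <= y -> f y - f x <= pos_var f y - pos_var f x.
Proof.
move=> xy; rewrite lerBrDr addrC -lerBrDr.
apply: ge_sup; first by exists 0; exact: var_sums0.
move=> _ [I [u [v [dis vx ->]]]]; rewrite lerBrDr.
apply: (sup_upper_bound (has_sup_var_sums y)).
exists (I + 'I_1)%type, (fun i => if i is inl j then u j else x),
  (fun i => if i is inl j then v j else y); split.
- split=> [[i|i]|[i|i] [j|j] z /= hi hj] //; first exact: dis.1.
  + by congr inl; exact: dis.2 hi hj.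
  + by exfalso; have := vx i; lra.
  + by exfalso; have := vx j; lra.
  + by congr inr; rewrite !ord1.
- by move=> [i|i] //; exact: le_trans xy.
- by rewrite big_sumType/= big_ord1.
Qed.

(** A nearly optimal family for y, cut at x, leaves at most pos_var f x below x.
    *)
Lemma pos_var_approx x y (e : R) : x <= y -> 0 < e ->
  exists (I : finType) (u v : I -> R), [/\ disjoint_itvs u v,
    forall i, x <= u i /\ v i <= y &
    pos_var f y - pos_var f x <= \sum_i (f (v i) - f (u i)) + e].
Proof.
move=> xy e0; have [_ [I [u [v [dis vy ->]]]] Hs] := sup_adherent e0 (has_sup_var_sums y).
exists I, (fun i => Num.max (u i) x), (fun i => Num.max (v i) x); split.
- exact: disjoint_itvs_max.
- by move=> i; rewrite le_max lexx orbT ge_max vy.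
- move: Hs; rewrite (eq_bigr _ (fun i _ => split_clamp f x (dis.1 i))) big_split/=.
  suff : \sum_i (f (Num.min (v i) x) - f (Num.min (u i) x)) <= pos_var f x.
    by rewrite -/(pos_var f y); lra.
  apply: (sup_upper_bound (has_sup_var_sums x)).
  exists I, (fun i => Num.min (u i) x), (fun i => Num.min (v i) x); split=> //.
  + exact: disjoint_itvs_min.
  + by move=> i; rewrite ge_min lexx orbT.
Qed.

(** Approximate the increment over each interval of a short family by a family
    inside it: together these are again a short family, to which the modulus of
    f applies. *)
Lemma pos_var_ac : globally_ac f -> globally_ac (pos_var f).
Proof.
move=> acf e e0; have e20 : 0 < e / 2 by lra.
have [d d0 H] := acf _ e20; exists d => // J x y dis dlt.
(* The successor avoids a division by 0 for an empty family. *)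
pose e' := e / 2 / #|J|.+1%:R.
have e'0 : 0 < e' by rewrite divr_gt0.
have := fun j => pos_var_approx (dis.1 j) e'0.
move=> /(_ _)/cid-/all_sig[I HI].
have {HI}/all_sig[u HI] := fun j => cid (HI j).
have {HI}/all_sig[v HI] := fun j => cid (HI j).
have disj j := let: And3 h _ _ := HI j in h.
have inj j := let: And3 _ h _ := HI j in h.
have apj j := let: And3 _ _ h := HI j in h.
pose T := {j : J & I j} : finType.
pose U (p : T) := u (tag p) (tagged p).
pose V (p : T) := v (tag p) (tagged p).
have disT : disjoint_itvs U V.
  split=> [[j i]|[j i] [k l] z]; first exact: (disj j).1.
  rewrite /U /V /= => h1 h2.
  have jk : j = k.
    apply: (dis.2 j k z).
      by have [a b] := inj j i; move: h1 => /andP[h1 h1']; rewrite (le_lt_trans a h1) (lt_le_trans h1' b).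
    by have [a b] := inj k l; move: h2 => /andP[h2 h2']; rewrite (le_lt_trans a h2) (lt_le_trans h2' b).
  subst k; congr existT; exact: (disj j).2 h1 h2.
have lenT : \sum_p (V p - U p) < d.
  apply: le_lt_trans dlt.
  rewrite -(@sig_big_dep _ _ _ _ _ xpredT (fun _ => xpredT) (fun j i => v j i - u j i))/=.
  by apply: ler_sum => j _; apply: disjoint_itvs_length => //; exact: dis.1.
have := H _ _ _ disT lenT.
rewrite -(@sig_big_dep _ _ _ _ _ xpredT (fun _ => xpredT) (fun j i => `|f (v j i) - f (u j i)|))/=.
move=> Hs; rewrite [ltRHS]splitr.
apply: le_lt_trans (_ : _ <= \sum_j (\sum_i `|f (v j i) - f (u j i)| + e')) _.
  apply: ler_sum => j _; rewrite ger0_norm ?subr_ge0 ?le_pos_var ?dis.1//.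
  apply: le_trans (apj j) _; rewrite lerD2r; apply: ler_sum => i _; exact: ler_norm.
rewrite big_split/= ltr_leD// sumr_const -mulr_natr.
rewrite [leLHS](_ : _ = e / 2 * (#|J|%:R / #|J|.+1%:R)); last by rewrite /e'; ring.
apply: (@le_trans _ _ (e / 2 * 1)); last by lra.
apply: ler_wpM2l; first by lra.
by rewrite ler_pdivrMr// mul1r ler_nat.
Qed.

End posvar.

(** * Domination of the Stieltjes measure by Lebesgue measure *)

Section dominated.
Context {R : realType}.
Notation mu := (@lebesgue_measure R).

(** Absolute continuity speaks of disjoint intervals, whereas the coverings that
    define an outer measure may overlap. A new interval ]A, B[ is made disjoint
    from the previous ones by cutting each of them into its parts left of A and
    right of B. *)
Lemma disjoint_refinement (n : nat) (a b : nat -> R) : (forall k, a k <= b k) ->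
  exists (I : finType) (u v : I -> R), [/\ disjoint_itvs u v,
    forall k x, (k < n)%N -> a k < x <= b k -> exists i, u i < x <= v i &
    \sum_i (v i - u i) <= \sum_(k < n) (b k - a k)].
Proof.
move=> ab; elim: n => [|n [I [u [v [dis cov len]]]]].
  exists 'I_0, (fun=> 0), (fun=> 0); split=> [||]; [|by []|by rewrite !big_ord0].
  by split=> //; case.
pose A := a n; pose B := b n; have AB : A <= B := ab n.
(* One new interval, then the left and the right parts of the old ones; a part
   that does not exist degenerates to an endpoint. *)
pose U (p : 'I_1 + (I + I)) := match p with
  | inl _ => A | inr (inl i) => u i | inr (inr i) => Num.min (v i) (Num.max (u i) B) end.
pose V (p : 'I_1 + (I + I)) := match p with
  | inl _ => B | inr (inl i) => Num.max (u i) (Num.min (v i) A) | inr (inr i) => v i end.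
have left i x : u i < x < Num.max (u i) (Num.min (v i) A) -> u i < x < v i /\ x < A.
  by have := dis.1 i; case_min_max; lra.
have right i x : Num.min (v i) (Num.max (u i) B) < x < v i -> u i < x < v i /\ B < x.
  by have := dis.1 i; case_min_max; lra.
exists ('I_1 + (I + I))%type, U, V; split.
- split=> [[i|[i|i]]|]; rewrite /U/V//.
  + by case_min_max; lra.
  + by have := dis.1 i; case_min_max; lra.
  move=> [i|[i|i]] [j|[j|j]] x /=.
  + by rewrite !ord1.
  + by move=> h /left h'; exfalso; lra.
  + by move=> h /right h'; exfalso; lra.
  + by move=> /left h' h; exfalso; lra.
  + by move=> /left[h1 _] /left[h2 _]; congr (inr (inl _)); exact: dis.2 h1 h2.
  + by move=> /left[_ h1] /right[_ h2]; exfalso; lra.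
  + by move=> /right h' h; exfalso; lra.
  + by move=> /right[_ h1] /left[_ h2]; exfalso; lra.
  + by move=> /right[h1 _] /right[h2 _]; congr (inr (inr _)); exact: dis.2 h1 h2.
- move=> k x; rewrite ltnS leq_eqVlt => /orP[/eqP->|kn] abx; first by exists (inl ord0).
  have [i hi] := cov k x kn abx.
  have [xA|Ax] := leP x A.
    by exists (inr (inl i)); rewrite /U/V; move: hi; case_min_max; lra.
  have [xB|Bx] := leP x B; first by exists (inl ord0); rewrite /U/V Ax.
  by exists (inr (inr i)); rewrite /U/V; move: hi; case_min_max; lra.
- rewrite big_ord_recr/= !big_sumType/= big_ord1 addrC lerD2r.
  apply: le_trans len; rewrite -big_split/=; apply: ler_sum => i _.
  by have := dis.1 i; case_min_max; lra.
Qed.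

Lemma le_measure_bigsetU d (T : measurableType d) (m : {measure set T -> \bar R})
  (I : finType) (F : I -> set T) : (forall i, measurable (F i)) ->
  (m (\big[setU/set0]_i F i) <= \sum_i m (F i))%E.
Proof.
move=> mF.
suff : measurable (\big[setU/set0]_i F i) /\ (m (\big[setU/set0]_i F i) <= \sum_i m (F i))%E by case.
apply: (big_rec2 (fun X y => measurable X /\ (m X <= y)%E)).
  by rewrite measure0.
move=> i y X _ [mX Xy]; split; first exact: measurableU.
by apply: (le_trans (measureU2 _ (mF i) mX)); exact: leeD.
Qed.

Lemma lebesgue_stieltjes_oc (P : cumulative R R) (a b : R) : a <= b ->
  lebesgue_stieltjes_measure P `]a, b] = (P b - P a)%:E.
Proof.
move=> ab; rewrite /lebesgue_stieltjes_measure /measure_extension/=.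
by rewrite measurable_mu_extE/= ?wlength_itv_bnd//; exact: is_ocitv.
Qed.

(** A Lebesgue null set has coverings of total length below the modulus of P for
    the error e; finitely many of their intervals have P-measure at most e after
    refinement, and the union is a limit of finite unions. *)
Lemma globally_ac_dominated (P : cumulative R R) :
  globally_ac P -> lebesgue_stieltjes_measure P `<< mu.
Proof.
move=> acP; apply/null_content_dominatesP => N mN N0.
have nd := cumulative_is_nondecreasing P.
apply/eqP; rewrite eq_le measure_ge0 andbT.
apply/lee_addgt0Pr => e e0; rewrite add0e.
have [d d0 H] := acP e e0.
have : (mu N < d%:E)%E by rewrite N0 lte_fin.
rewrite /lebesgue_measure/= /lebesgue_stieltjes_measure/= /measure_extension.
rewrite /mu_ext => /ereal_inf_lt[_ [A [mA NA] <-] sA].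
have /choice[ab abE] : forall k, exists x : R * R, x.1 <= x.2 /\ A k = `]x.1, x.2]%classic.
  move=> k; have /ocitvP[->|[x xlt ->]] := mA k.
    by exists (0, 0) => /=; rewrite set_itvoc0.
  by exists x; split => //; exact: ltW.
have Aoc k : (A k : set R) = `](ab k).1, (ab k).2]%classic := (abE k).2.
have mAk k : measurable (A k : set (measurableTypeR R)).
  by rewrite Aoc; exact: measurable_itv.
pose F n := (\big[setU/set0]_(k < n) (A k : set (measurableTypeR R))).
have FP n : (lebesgue_stieltjes_measure P (F n) <= e%:E)%E.
  have [I [u [v [dis cov len]]]] :=
    @disjoint_refinement n (fun k => (ab k).1) (fun k => (ab k).2) (fun k => (abE k).1).
  have lend : \sum_i (v i - u i) < d.
    apply: le_lt_trans len _; rewrite -lte_fin; apply: le_lt_trans sA.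
    rewrite -sumEFin (eq_bigr (fun k : 'I_n => wlength idfun (A k))); last first.
      by move=> k _; rewrite Aoc wlength_itv_bnd//; exact: (abE k).1.
    rewrite -(big_mkord xpredT (fun k => wlength idfun (A k))).
    apply: nneseries_lim_ge => k _ _; rewrite Aoc wlength_itv_bnd ?lee_fin ?subr_ge0//.
    exact: (abE k).1. exact: (abE k).1.
  have := H _ _ _ (disjoint_itvs_ord dis).
  rewrite -(@sum_reindex_ord _ _ (fun i => v i - u i)) => /(_ lend)/ltW lene.
  pose G := \big[setU/set0]_(k < #|I|) ([set` `]u (enum_val k), v (enum_val k)]] : set (measurableTypeR R)).
  apply: (@le_trans _ _ (lebesgue_stieltjes_measure P G)).
    apply: le_measure; rewrite ?inE; [exact: bigsetU_measurable|exact: bigsetU_measurable|].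
    rewrite /F /G -bigcup_mkord -bigcup_seq => x [k /= kn]; rewrite Aoc/= in_itv/= => xk.
    have [i hi] := cov k x kn xk; exists (enum_rank i); first by rewrite /= mem_index_enum.
    by rewrite /= enum_rankK in_itv/=.
  rewrite -lee_fin in lene; apply: le_trans lene.
  apply: (@le_trans _ _ (\sum_(k < #|I|) lebesgue_stieltjes_measure P [set` `]u (enum_val k), v (enum_val k)]])%E).
    exact: le_measure_bigsetU.
  rewrite -sumEFin; apply: lee_sum => k _.
  by rewrite lebesgue_stieltjes_oc ?lee_fin ?ler_norm//; exact: dis.1.
have cvF : lebesgue_stieltjes_measure P (F n) @[n --> \oo] --> lebesgue_stieltjes_measure P (\bigcup_n F n).
  apply: nondecreasing_cvg_mu.
  - by move=> n; exact: bigsetU_measurable.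
  - by apply: bigcupT_measurable => n; exact: bigsetU_measurable.
  - by move=> n m nm; apply/subsetPset; exact: subset_bigsetU.
apply: (@le_trans _ _ (lebesgue_stieltjes_measure P (\bigcup_n F n))).
  apply: le_measure; rewrite ?inE//.
    by apply: bigcupT_measurable => n; exact: bigsetU_measurable.
  move=> x /NA[k _ Akx]; exists k.+1 => //.
  by rewrite /F big_ord_recr/=; right.
rewrite -(cvg_lim _ cvF)//; apply: lime_le; last by near=> n; exact: FP.
by apply/cvg_ex; exists (lebesgue_stieltjes_measure P (\bigcup_n F n)).
Unshelve. all: by end_near. Qed.

End dominated.

(** * The fundamental theorem of calculus for absolutely continuous functions *)

Section density.
Context {R : realType}.
Notation mu := (@lebesgue_measure R).

(** p is the Radon-Nikodym density, taken after restriction to ]a, b] in order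
    to have a finite measure; the derivative comes from the Lebesgue
    differentiation theorem. *)
Lemma cumulative_ac_density (P : cumulative R R) (a b : R) : a < b ->
  globally_ac P -> exists p : R -> R, [/\
    mu.-integrable `]a, b] (EFin \o p),
    (\int[mu]_(x in `]a, b]) (p x)%:E = (P b - P a)%:E)%E &
    {ae mu, forall x, a < x < b -> is_derive x 1 P (p x)}].
Proof.
move=> ab acP.
have mD : measurable (`]a, b]%classic : set (measurableTypeR R)) by exact: measurable_itv.
have Dfin : (lebesgue_stieltjes_measure P `]a, b]%classic < +oo)%E.
  by rewrite lebesgue_stieltjes_oc ?ltW// ltry.
pose nu := mfrestr mD Dfin.
have nu_mu : nu `<< mu.
  apply/null_content_dominatesP => N mN N0.
  have /null_content_dominatesP := globally_ac_dominated acP; move=> /(_ N mN N0) PN0.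
  apply: (@subset_measure0 _ _ _ (lebesgue_stieltjes_measure P) _ N) => //.
  exact: measurableI.
have [p' [p'0 p'fin ip' nuE]] := radon_nikodym_sigma_finite nu_mu.
have {}nuE A : measurable A -> lebesgue_stieltjes_measure P (A `&` `]a, b]%classic) =
    (\int[mu]_(x in A) p' x)%E by exact: nuE.
pose p : R -> R := fun x => fine (p' x).
have pE : EFin \o p = p' by apply/funext => x /=; rewrite fineK.
exists p; have ip : mu.-integrable setT (EFin \o p) by rewrite pE.
split.
- by apply: integrableS ip.
- rewrite -[LHS]/(\int[mu]_(x in `]a, b]) ((EFin \o p) x))%E pE -nuE//.
  by rewrite setIid lebesgue_stieltjes_oc// ltW.
have locp : locally_integrable setT p.
  by rewrite -(patch_setT (fun=> 0) p); exact: integrable_locally.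
have ipy y : mu.-integrable `]-oo, y] (EFin \o p).
  by apply: integrableS ip => //; exact: measurable_itv.
have := FTC1Ny ipy locp.
apply: filterS; first exact: (ae_filter_ringOfSetsType mu).
move=> x + /andP[ax xb] => -[dF F'].
have PE : \forall y \near x, P y - P a = (\int[mu]_(t in [set` `]-oo, y]]) p t)%R.
  near=> y.
  have ay : a < y by near: y; exact: lt_nbhsr.
  have yb : y < b by near: y; exact: lt_nbhsl.
  rewrite /Rintegral -[X in fine X]/(\int[mu]_(x in `]-oo, y]) ((EFin \o p) x))%E pE.
  rewrite -nuE; last exact: measurable_itv.
  have -> : `]-oo, y]%classic `&` `]a, b]%classic = `]a, y]%classic.
    apply/seteqP; split=> z /=; rewrite !in_itv/=; first by move=> [-> /andP[->]].
    by move=> /andP[-> zy]; rewrite zy (le_trans zy (ltW yb)).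
  by rewrite lebesgue_stieltjes_oc// ltW.
have dF1 : is_derive x 1 (fun y : R => (\int[mu]_(t in [set` `]-oo, y]]) p t)%R) (p x).
  exact: (DeriveDef dF (etrans (esym (derive1E _ _)) F')).
have dP : is_derive x 1 (fun y => P y - P a) (p x).
  by apply: near_eq_is_derive dF1; near do apply: esym.
have -> : (P : R -> R) = (fun y => P y - P a) + cst (P a).
  by apply/funext => y /=; rewrite fctE subrK.
by rewrite -[p x]addr0; apply: is_deriveD.
Unshelve. all: by end_near. Qed.

(** f is the difference of its positive variation and of pos_var f - f, which
    are both nondecreasing and absolutely continuous. *)
Lemma ac_derivative (f : R -> R) (a b : R) : a < b -> absolutely_continuous a b f ->
  exists g : R -> R, [/\ mu.-integrable `]a, b] (EFin \o g),
    (\int[mu]_(x in `]a, b]) (g x)%:E = (f b - f a)%:E)%E &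
    {ae mu, forall x, a < x < b -> is_derive x 1 f (g x)}].
Proof.
move=> ab acf; have leab := ltW ab.
pose h := f \o clamp a b.
have ach : globally_ac h := ac_globally leab acf.
have hcl x : h (clamp a b x) = h x.
  by rewrite /h /= (@clamp_id _ a b (clamp a b x))// clamp_itv.
have bvh := ac_bounded_var leab ach hcl.
have acP := pos_var_ac bvh ach.
have acQ := globally_acB acP ach.
have ndP : nondecreasing (pos_var h) by move=> x y; exact: le_pos_var.
have ndQ : nondecreasing (pos_var h \- h).
  by move=> x y xy /=; have := pos_var_increment bvh xy; lra.
pose cP : cumulative R R := HB.pack (pos_var h) (isCumulative.Build R _ R (pos_var h) ndP
  (right_continuousW (globally_ac_continuous acP))).
pose cQ : cumulative R R := HB.pack (pos_var h \- h) (isCumulative.Build R _ R (pos_var h \- h) ndQ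
  (right_continuousW (globally_ac_continuous acQ))).
have [p [ip intp aep]] := @cumulative_ac_density cP a b ab acP.
have [q [iq intq aeq]] := @cumulative_ac_density cQ a b ab acQ.
exists (p \- q); split.
- by rewrite (_ : EFin \o _ = (EFin \o p) \- (EFin \o q))%E//; exact: integrableB.
- under eq_integral do rewrite EFinB.
  rewrite integralB_EFin// intp intq -EFinB; congr EFin.
  rewrite /cP /cQ /=.
  have -> : f a = h a by rewrite /h /= clamp_id// lexx.
  have -> : f b = h b by rewrite /h /= clamp_id// lexx leab.
  lra.
- apply: filterS2 aep aeq; first exact: (ae_filter_ringOfSetsType mu).
  move=> x dp dq axb.
  have {}dp := dp axb; have {}dq := dq axb.
  have dh : is_derive x 1 ((pos_var h) - (pos_var h \- h)) (p x - q x) by exact: is_deriveB.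
  apply: near_eq_is_derive dh; move: axb => /andP[ax xb]; near=> y.
  rewrite fctE /= opprB addrC subrK /h /= clamp_id//.
  by apply/andP; split; apply: ltW; near: y; [exact: lt_nbhsr|exact: lt_nbhsl].
Unshelve. all: by end_near. Qed.

(** The integral of a nonnegative function is a supremum over the simple
    functions below it, so no measurability is needed for monotonicity. *)
Lemma le_integral_nonneg (D : set R) (f g : R -> \bar R) :
  (forall x, D x -> (0 <= f x)%E) -> (forall x, D x -> (f x <= g x)%E) ->
  (\int[mu]_(x in D) f x <= \int[mu]_(x in D) g x)%E.
Proof.
move=> f0 fg; rewrite !ge0_integralE//; last by move=> x Dx; exact: le_trans (f0 x Dx) (fg x Dx).
apply: le_ereal_sup => _ [h hf <-]; exists h => // x; apply: le_trans (hf x) _.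
by rewrite /patch; case: ifPn => // /set_mem /fg.
Qed.

(** This is all that is used of the fundamental theorem. As h need not be
    measurable and f need not be differentiable everywhere, h is compared on the
    good points with the positive part of the derivative. *)
Lemma ac_integral_ge (f : R -> R) (h : R -> \bar R) (a b : R) : a < b ->
  absolutely_continuous a b f ->
  (forall x, (0 <= h x)%E) ->
  {ae mu, forall x, a < x < b -> derivable f x 1 -> ((derive1 f x)%:E <= h x)%E} ->
  ((f b - f a)%:E <= \int[mu]_(x in `[a, b]) h x)%E.
Proof.
move=> ab acf h0 [N1 [mN1 N10 hN1]].
have [g [ig intg [N2 [mN2 N20 hN2]]]] := ac_derivative ab acf.
(* b is excluded as well: derivatives are known in the open interval only. *)
pose N := N1 `|` N2 `|` [set b].
have mN : measurable N by apply: measurableU => //; apply: measurableU.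
have N0 : mu N = 0.
  have U0 (A B : set R) : measurable A -> measurable B -> mu A = 0 -> mu B = 0 ->
      mu (A `|` B) = 0.
    move=> mA mB A0 B0; apply/eqP; rewrite eq_le measure_ge0 andbT.
    have AB0 : (mu A + mu B = 0)%E by rewrite A0 B0 adde0.
    by apply: le_trans (_ : mu A + mu B <= 0)%E; [exact: measureU2|rewrite AB0].
  apply: (U0 (N1 `|` N2) [set b]) => //; [exact: measurableU|exact: U0|].
  exact: lebesgue_measure_set1.
rewrite -intg.
have mab : measurable (`]a, b]%classic : set (measurableTypeR R)).
  exact: measurable_itv.
have igp := integrable_funepos mab ig.
have mgp := measurable_int _ igp.
apply: (@le_trans _ _ (\int[mu]_(x in `]a, b]) (EFin \o g)^\+ x)%E).
  apply: le_integral => //.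
  by move=> x _; rewrite funeposE le_max lexx.
rewrite (@ge0_negligible_integral _ _ _ mu _ N)//.
apply: (@le_trans _ _ (\int[mu]_(x in `]a, b] `\` N) h x)%E).
  apply: le_integral_nonneg => // x [/=]; rewrite in_itv/= => /andP[ax xb] nN.
  rewrite funeposE ge_max h0 andbT.
  have {}xb : a < x < b.
    by rewrite ax lt_neqAle xb andbT; apply/eqP => xbE; apply: nN; right.
  have dx : is_derive x 1 f (g x).
    by apply: contrapT => nd; apply: nN; left; right; apply: hN2 => /= /(_ xb).
  have : derivable f x 1 -> ((derive1 f x)%:E <= h x)%E.
    by apply: contrapT => nd; apply: nN; left; left; apply: hN1 => /= /(_ xb).
  by rewrite derive1E (@derive_val _ _ _ _ _ _ _ dx); apply; exact: ex_derive.
rewrite [leLHS]integral_mkcond [leRHS]integral_mkcond.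
apply: le_integral_nonneg => x _.
  by apply: erestrict_ge0 => y _; exact: h0.
rewrite /patch; case: ifPn => [/set_mem[/= xab _]|_]; last by case: ifP.
by rewrite ifT//; apply/mem_set; move: xab; rewrite /= !in_itv/= => /andP[/ltW -> ->].
Qed.

End density.

(** * Derivatives of real functions *)

Section calculus.
Context {R : realType}.
Implicit Types (f g : R -> R) (x a b c : R).

Lemma der_cst c x : is_derive x 1 (fun=> c : R) (0 : R).
Proof. exact: is_derive_cst. Qed.

Lemma der_id x : is_derive x 1 (fun y : R => y) (1 : R).
Proof. exact: is_derive_id. Qed.

Lemma der_add f g x a b : is_derive x 1 f a -> is_derive x 1 g b ->
  is_derive x 1 (fun y => f y + g y) (a + b).
Proof. by move=> df dg; exact: is_deriveD. Qed.

Lemma der_sub f g x a b : is_derive x 1 f a -> is_derive x 1 g b ->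
  is_derive x 1 (fun y => f y - g y) (a - b).
Proof. by move=> df dg; exact: is_deriveB. Qed.

Lemma der_mul f g x a b : is_derive x 1 f a -> is_derive x 1 g b ->
  is_derive x 1 (fun y => f y * g y) (a * g x + f x * b).
Proof.
move=> df dg; apply: (is_derive_eq (is_deriveM df dg)).
by rewrite addrC; congr (_ + _); exact: mulrC.
Qed.

Lemma der_scale f x a c : is_derive x 1 f a -> is_derive x 1 (fun y => c * f y) (c * a).
Proof. by move=> df; exact: is_deriveZ. Qed.

Lemma der_comp f g x a b : is_derive (g x) 1 f a -> is_derive x 1 g b ->
  is_derive x 1 (fun y => f (g y)) (a * b).
Proof. by move=> df dg; apply: (is_derive_eq (is_derive1_comp df dg)). Qed.

Lemma der_ln g x b : 0 < g x -> is_derive x 1 g b ->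
  is_derive x 1 (fun y => ln (g y)) (b / g x).
Proof.
by move=> g0 dg; rewrite mulrC; apply: der_comp dg; exact: is_derive1_ln.
Qed.

Lemma der_exp g x b : is_derive x 1 g b ->
  is_derive x 1 (fun y => expR (g y)) (expR (g x) * b).
Proof. by move=> dg; apply: der_comp dg; exact: is_derive_expR. Qed.

Lemma der_opp g x b : is_derive x 1 g b -> is_derive x 1 (fun y => - g y) (- b).
Proof. by move=> dg; exact: is_deriveN. Qed.

Lemma der_inv g x b : g x != 0 -> is_derive x 1 g b ->
  is_derive x 1 (fun y => (g y)^-1) (- b / g x ^+ 2).
Proof.
move=> g0 dg; have dV : derivable (fun y => (g y)^-1) x 1 by apply: derivableV.
apply: (DeriveDef dV); rewrite (@deriveV _ _ g x 1 g0)// derive_val.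
by rewrite -exprVn mulrC -[LHS]/(_ * _); ring.
Qed.

Lemma der_sqr g x b : is_derive x 1 g b ->
  is_derive x 1 (fun y => g y ^+ 2) (2 * g x * b).
Proof.
move=> dg; under eq_fun do rewrite expr2.
by apply: (is_derive_eq (der_mul dg dg)); ring.
Qed.

Lemma derive_continuous f x a : is_derive x 1 f a -> {for x, continuous f}.
Proof.
move=> df; apply/differentiable_continuous/derivable1_diffP; exact: ex_derive.
Qed.

End calculus.

(** Derivative rules are applied by plain unification, since instance search
    would produce scalings instead of products, which [field] does not accept.
    *)
Ltac derive_step := first
  [ eassumption
  | notypeclasses refine (der_cst _ _) | notypeclasses refine (der_id _)
  | notypeclasses refine (der_opp _)
  | notypeclasses refine (der_sub _ _) | notypeclasses refine (der_add _ _)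
  | notypeclasses refine (der_sqr _) | notypeclasses refine (der_mul _ _)
  | notypeclasses refine (der_exp _) | notypeclasses refine (der_ln _ _)
  | notypeclasses refine (der_inv _ _) ].
Ltac derive_by tac := notypeclasses refine (is_derive_eq _ _);
  [ repeat (first [ tac | derive_step ]) | cbv beta ].
Ltac derive_auto := derive_by fail.

(** * The Lagrangian as a Legendre transform *)

Section legendre.
Context {R : realType}.
Implicit Types (m v Q x : R).

(** p v - H(m, p) in the variable Q = exp (2 p), where H(m, p) = cosh 2p - 1 - m
    sinh 2p. *)
Definition legendre_bound m v Q : R :=
  v / 2 * ln Q - ((1 - m) * Q + (1 + m) / Q) / 2 + 1.

Lemma ln_le_sub1 x : 0 < x -> ln x <= x - 1.
Proof.
by move=> x0; rewrite [X in ln X](_ : x = 1 + (x - 1)); [apply: le_ln1Dx; lra|ring].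
Qed.

(** Let P be the argument of the logarithm in the Lagrangian; then (1 - m) P and
    (1 + m) / P are (S + v) / 2 and (S - v) / 2, where S is the square root, and
    the difference of the two sides is a combination, with the weights (1 - m) /
    2 and (1 + m) / 2, of two relative entropies x ln (x / y) - x + y, at (P, Q)
    and at (1 / P, 1 / Q). *)
Lemma legendre_bound_le m v Q : `|m| < 1 -> 0 < Q ->
  legendre_bound m v Q <= lagrangian_int m v.
Proof.
rewrite ltr_norml => /andP[m1 m2] Q0; rewrite /legendre_bound /lagrangian_int.
set S := Num.sqrt _.
have m10 : 0 < 1 - m by lra.
have D0 : 0 < 4 * (1 - m ^+ 2) by nra.
have S2 : S ^+ 2 = 4 * (1 - m ^+ 2) + v ^+ 2 by rewrite sqr_sqrtr//; nra.
have S0 : 0 <= S by exact: sqrtr_ge0.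
have Sv : 0 < S + v by nra.
set P := (S + v) / (2 * (1 - m)).
have P0 : 0 < P by apply: divr_gt0 => //; apply: mulr_gt0.
have PE : (1 - m) * P = (S + v) / 2 by rewrite /P; field; lra.
have iPE : (1 + m) / P = (S - v) / 2.
  apply: (mulIf (lt0r_neq0 P0)); rewrite divfK ?lt0r_neq0//.
  apply: (@mulfI _ (1 - m)); first by rewrite subr_eq0 gt_eqF.
  rewrite [RHS]mulrCA PE; nra.
clearbody P.
have h1 := ln_le_sub1 (divr_gt0 Q0 P0).
have h2 := ln_le_sub1 (divr_gt0 P0 Q0).
move: h1 h2; rewrite !ln_div ?posrE// => h1 h2.
have g1 : P - Q <= P * (ln P - ln Q).
  have -> : P - Q = P * (1 - Q / P) by field; rewrite lt0r_neq0.
  by rewrite ler_pM2l//; lra.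
have g2 : P^-1 - Q^-1 <= P^-1 * (ln Q - ln P).
  have -> : P^-1 - Q^-1 = P^-1 * (1 - P / Q) by field; rewrite !lt0r_neq0.
  by rewrite ler_pM2l ?invr_gt0//; lra.
have k1 : 0 <= (1 - m) * (P * (ln P - ln Q) - (P - Q)) by rewrite mulr_ge0//; lra.
have k2 : 0 <= (1 + m) * (P^-1 * (ln Q - ln P) - (P^-1 - Q^-1)) by rewrite mulr_ge0//; lra.
have e1 : (1 - m) * (P * (ln P - ln Q) - (P - Q)) =
   (S + v) / 2 * (ln P - ln Q) - (S + v) / 2 + (1 - m) * Q by rewrite -PE; ring.
have e2 : (1 + m) * (P^-1 * (ln Q - ln P) - (P^-1 - Q^-1)) =
   (S - v) / 2 * (ln Q - ln P) - (S - v) / 2 + (1 + m) / Q by rewrite -iPE; ring.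
move: k1 k2; rewrite e1 e2; lra.
Qed.

(** The hypothesis says v = dH/dp, the case of equality in the Fenchel
    inequality. *)
Lemma lagrangian_int_momentum m v Q : `|m| < 1 -> 0 < Q ->
  v = (1 - m) * Q - (1 + m) / Q -> lagrangian_int m v = legendre_bound m v Q.
Proof.
rewrite ltr_norml => /andP[m1 m2] Q0 vE; rewrite /legendre_bound /lagrangian_int.
have -> : 4 * (1 - m ^+ 2) + v ^+ 2 = ((1 - m) * Q + (1 + m) / Q) ^+ 2.
  by rewrite vE; field; rewrite lt0r_neq0.
rewrite sqrtr_sqr ger0_norm; last first.
  by apply: addr_ge0; [apply: mulr_ge0|apply: divr_ge0]; lra.
have -> : ((1 - m) * Q + (1 + m) / Q + v) / (2 * (1 - m)) = Q.
  have m10 : 0 < 1 - m by lra.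
  by rewrite vE; field; rewrite !lt0r_neq0.
lra.
Qed.

(** At m = 1 and m = -1 the bound passes to the lower limit because it is
    continuous in (m, v). *)
Lemma legendre_bound_lagrangian m v Q : `|m| <= 1 -> 0 < Q ->
  ((legendre_bound m v Q)%:E <= lagrangian m v)%E.
Proof.
move=> m1 Q0; rewrite /lagrangian; case: ifPn => [mlt|_].
  by rewrite lee_fin legendre_bound_le.
rewrite limf_einfE; apply/lee_addgt0Pr => e e0.
rewrite -leeBlDr// -EFinB.
apply: ereal_sup_ge; last first.
  exists (ereal_inf ((fun p : R * R => (lagrangian_int p.1 p.2)%:E) @`
    [set p : R * R | `|p.1| < 1 /\ legendre_bound m v Q - e < legendre_bound p.1 p.2 Q])) => //.
  exists [set p : R * R | `|p.1| < 1 /\ legendre_bound m v Q - e < legendre_bound p.1 p.2 Q] => //.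
  have cnt : (fun p : R * R => legendre_bound p.1 p.2 Q) p @[p --> (m, v)] --> legendre_bound m v Q.
    rewrite /legendre_bound; apply: cvgD; last exact: cvg_cst.
    apply: cvgB.
      apply: cvgM; last exact: cvg_cst.
      by apply: cvgM; [exact: cvg_snd|exact: cvg_cst].
    apply: cvgM; last exact: cvg_cst.
    apply: cvgD.
      by apply: cvgM; [apply: cvgB; [exact: cvg_cst|exact: cvg_fst]|exact: cvg_cst].
    by apply: cvgM; [apply: cvgD; [exact: cvg_cst|exact: cvg_fst]|exact: cvg_cst].
  have : \forall p \near (m, v), legendre_bound m v Q - e < legendre_bound p.1 p.2 Q.
    by apply: (cvgr_gt _ cnt); lra.
  by rewrite /within/=; apply: filterS => p hp hp1.
apply: le_ereal_inf_tmp => _ [p [p1 hp] <-]; rewrite lee_fin.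
by apply: le_trans (ltW hp) _; exact: legendre_bound_le.
Qed.

Lemma lagrangian_ge0 m v : `|m| <= 1 -> (0 <= lagrangian m v)%E.
Proof.
move=> m1; apply: le_trans (@legendre_bound_lagrangian m v 1 m1 ltr01).
by rewrite /legendre_bound ln1 lee_fin; lra.
Qed.

End legendre.

(** * Lower bound for the cost *)

Section acsuff.
Context {R : realType}.

(** Serves for u + w phi with u, w Lipschitz. *)
Lemma ac_dominated (a b K M : R) (phi psi : R -> R) : 0 <= K -> 0 <= M ->
  absolutely_continuous a b phi ->
  (forall x y, a <= x -> x <= y -> y <= b ->
     `|psi y - psi x| <= K * (y - x) + M * `|phi y - phi x|) ->
  absolutely_continuous a b psi.
Proof.
move=> K0 M0 acphi H e e0.
have eM : 0 < e / 2 / (M + 1) by rewrite !divr_gt0//; lra.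
have eK : 0 < e / 2 / (K + 1) by rewrite !divr_gt0//; lra.
have [d d0 Hd] := acphi _ eM.
exists (Num.min d (e / 2 / (K + 1))); first by rewrite lt_min d0.
move=> n u v uv dis; rewrite lt_min => /andP[s1 s2].
apply: le_lt_trans (_ : _ <= \sum_(i < n) (K * (v i - u i) + M * `|phi (v i) - phi (u i)|)) _.
  by apply: ler_sum => i _; have [h1 [h2 h3]] := uv i; exact: H.
rewrite big_split/= -!mulr_sumr.
have t1 : 0 <= \sum_(i < n) (v i - u i).
  by apply: sumr_ge0 => i _; have [h1 [h2 h3]] := uv i; rewrite subr_ge0.
have := Hd n u v uv dis s1.
have t2 : 0 <= \sum_(i < n) `|phi (v i) - phi (u i)| by exact: sumr_ge0.
rewrite ltr_pdivlMr in s2; last by lra.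
rewrite ltr_pdivlMr; last by lra.
nra.
Qed.

Lemma ac_lipschitz (a b K : R) (psi : R -> R) : 0 <= K ->
  (forall x y, a <= x -> x <= y -> y <= b -> `|psi y - psi x| <= K * (y - x)) ->
  absolutely_continuous a b psi.
Proof.
move=> K0 H; apply: (@ac_dominated _ _ K 0 (fun=> 0)) => //.
- move=> e e0; exists 1 => // n u v _ _ _; rewrite big1// => i _.
  by rewrite subrr normr0.
- by move=> x y ax xy yb; rewrite mul0r addr0; exact: H.
Qed.

Lemma ln_lipschitz (d p q : R) : 0 < d -> d <= p -> d <= q ->
  `|ln p - ln q| <= `|p - q| / d.
Proof.
move=> d0; wlog pq : p q / q <= p => [H|] dp dq.
  by have [/H|/ltW/H] := leP q p; [exact|rewrite distrC [X in _ <= X / _]distrC; exact].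
have q0 : 0 < q by exact: lt_le_trans dq.
have p0 : 0 < p by exact: lt_le_trans dp.
rewrite !ger0_norm ?subr_ge0 ?ler_ln ?posrE//.
rewrite -ln_div ?posrE//; apply: le_trans (ln_le_sub1 (divr_gt0 p0 q0)) _.
have -> : p / q - 1 = (p - q) / q by field; rewrite lt0r_neq0.
by rewrite ler_wpM2l ?subr_ge0// lef_pV2 ?posrE.
Qed.

Lemma ln_abs_le (d p : R) : 0 < d -> d <= 1 -> d <= p -> p <= 2 -> `|ln p| <= d^-1.
Proof.
move=> d0 d1 dp p2; have p0 : 0 < p by exact: lt_le_trans dp.
have h1 := ln_le_sub1 p0.
have ip0 : 0 < p^-1 by rewrite invr_gt0.
have h2 := ln_le_sub1 ip0; rewrite lnV ?posrE// in h2.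
have h3 : p^-1 <= d^-1 by rewrite lef_pV2 ?posrE.
have h4 : 1 <= d^-1 by rewrite -invr1 lef_pV2 ?posrE.
by rewrite ler_norml; apply/andP; split; lra.
Qed.

End acsuff.

Section cost_bounds.
Context {R : realType}.
Notation mu := (@lebesgue_measure R).
Implicit Types (J t z m s : R).

(** The factor by which the mean magnetization of independently flipping spins
    decays in time t. *)
Definition relax t : R := expR (- (2 * t)).

(** Minus the logarithmic moment generating function, per spin, of the
    magnetization at time t, started from m, at the parameter x with tanh x = -
    z. Its supremum over z is the cost of reaching 0 from m. *)
Definition dual_value t z m : R :=
  - ((1 + m) * ln (1 - relax t * z) + (1 - m) * ln (1 + relax t * z)
     - ln (1 - z ^+ 2)) / 2.

Lemma relax_gt0 t : 0 < relax t. Proof. exact: expR_gt0. Qed.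

Lemma relax_le1 t : 0 <= t -> relax t <= 1.
Proof. by move=> t0; rewrite /relax -[leRHS]expR0 ler_expR; lra. Qed.

Lemma relax_bound t z d : 0 <= t -> `|z| <= 1 - d ->
  [/\ d <= 1 - relax t * z, d <= 1 + relax t * z,
      1 - relax t * z <= 2 - d & 1 + relax t * z <= 2 - d].
Proof.
move=> t0; rewrite ler_norml => /andP[z1 z2].
have e0 := relax_gt0 t; have e1 := relax_le1 t0.
have p1 : 0 <= relax t * (1 - d - z) by apply: mulr_ge0; lra.
have p2 : 0 <= relax t * (z + (1 - d)) by apply: mulr_ge0; lra.
have p3 : 0 <= (1 - relax t) * (1 - d) by apply: mulr_ge0; lra.
by split; lra.
Qed.

Lemma is_derive_relax t s :
  is_derive s 1 (fun s => relax (t - s)) (2 * relax (t - s)).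
Proof.
rewrite /relax; derive_auto.
ring.
Qed.

Lemma relax_lipschitz t s s' : s <= s' -> s' <= t ->
  `|relax (t - s') - relax (t - s)| <= 2 * (s' - s).
Proof.
move=> ss s't; rewrite /relax ger0_norm; last first.
  by rewrite subr_ge0 ler_expR; lra.
have -> : expR (- (2 * (t - s))) = expR (- (2 * (t - s'))) * expR (- (2 * (s' - s))).
  by rewrite -expRD; congr expR; ring.
have h1 : expR (- (2 * (t - s'))) <= 1 by apply: relax_le1; lra.
have h2 := expR_gt0 (- (2 * (t - s'))).
have h3 := expR_ge1Dx (- (2 * (s' - s))).
nra.
Qed.

Context (t z : R) (z1 : `|z| < 1).

Let ratio s := (1 - relax (t - s) * z) / (1 + relax (t - s) * z).

(** The Hamilton-Jacobi equation: along any path phi the derivative of -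
    dual_value is the Legendre expression with the momentum p given by exp (2 p)
    = (1 - e z) / (1 + e z). *)
Lemma is_derive_dual_value (phi : R -> R) s v : s <= t -> is_derive s 1 phi v ->
  is_derive s 1 (fun s => - dual_value (t - s) z (phi s))
    (legendre_bound (phi s) v (ratio s)).
Proof.
move=> st dphi; rewrite /dual_value.
have t0 : 0 <= t - s by lra.
have d0 : 0 < 1 - `|z| by rewrite subr_gt0.
have zb : `|z| <= 1 - (1 - `|z|) by rewrite opprB addrC subrK.
have [b1 b2 _ _] := relax_bound t0 zb.
have p1 : 0 < 1 - relax (t - s) * z by exact: lt_le_trans b1.
have p2 : 0 < 1 + relax (t - s) * z by exact: lt_le_trans b2.
derive_by ltac:(notypeclasses refine (is_derive_relax _ _)) => //.
rewrite /legendre_bound /ratio ln_div ?posrE//.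
move: (relax (t - s)) (ln (1 - _)) (ln (1 + _)) (phi s) p1 p2 => e l1 l2 p p1 p2.
by field; rewrite !lt0r_neq0.
Qed.

Lemma ac_dual_value (phi : R -> R) : 0 < t -> absolutely_continuous 0 t phi ->
  (forall s, 0 <= s <= t -> `|phi s| <= 1) ->
  absolutely_continuous 0 t (fun s => - dual_value (t - s) z (phi s)).
Proof.
move=> t0 acphi phi1.
set d := 1 - `|z|.
have d0 : 0 < d by rewrite subr_gt0.
have d1 : d <= 1 by rewrite lerBlDr lerDl.
have zd : `|z| <= 1 - d by rewrite opprB addrC subrK.
have id0 : 0 < d^-1 by rewrite invr_gt0.
apply: (@ac_dominated _ _ _ (4 * d^-1) (d^-1) phi) => //.
  by rewrite mulr_ge0// ltW.
  exact: ltW.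
move=> x y x0 xy yt.
have [a1 a2 a3 a4] := @relax_bound (t - x) z d ltac:(lra) zd.
have [b1 b2 b3 b4] := @relax_bound (t - y) z d ltac:(lra) zd.
have rl := relax_lipschitz xy yt.
have z1' := ltW z1.
have rz : `|relax (t - y) - relax (t - x)| * `|z| <= 2 * (y - x).
  by apply: le_trans rl; rewrite ler_piMr.
have dm : `|ln (1 - relax (t - y) * z) - ln (1 - relax (t - x) * z)| <= 2 * (y - x) / d.
  apply: le_trans (ln_lipschitz d0 b1 a1) _; rewrite ler_wpM2r ?(ltW id0)//.
  apply: le_trans rz; rewrite -normrM le_eqVlt; apply/orP; left; apply/eqP.
  by rewrite -normrN; congr (`| _ |); ring.
have dp : `|ln (1 + relax (t - y) * z) - ln (1 + relax (t - x) * z)| <= 2 * (y - x) / d.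
  apply: le_trans (ln_lipschitz d0 b2 a2) _; rewrite ler_wpM2r ?(ltW id0)//.
  apply: le_trans rz; rewrite -normrM le_eqVlt; apply/orP; left; apply/eqP.
  by congr (`| _ |); ring.
have lm : `|ln (1 - relax (t - x) * z)| <= d^-1.
  by apply: ln_abs_le => //; lra.
have lp : `|ln (1 + relax (t - x) * z)| <= d^-1.
  by apply: ln_abs_le => //; lra.
have py : `|phi y| <= 1 by apply: phi1; lra.
rewrite /dual_value.
move: dm dp lm lp py.
set l1 := ln (1 - relax (t - y) * z); set l2 := ln (1 - relax (t - x) * z).
set l3 := ln (1 + relax (t - y) * z); set l4 := ln (1 + relax (t - x) * z).
move=> dm dp lm lp py.
rewrite [X in `|X|](_ : _ = (1 + phi y) / 2 * (l1 - l2) + (1 - phi y) / 2 * (l3 - l4)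
  + (phi y - phi x) * ((l2 - l4) / 2)); last by ring.
have q1 : 0 <= (1 + phi y) / 2 by move: py; rewrite ler_norml => /andP[]; lra.
have q2 : 0 <= (1 - phi y) / 2 by move: py; rewrite ler_norml => /andP[]; lra.
apply: le_trans (ler_normD _ _) _; apply: lerD.
  apply: le_trans (ler_normD _ _) _; rewrite (normrM ((1 + phi y) / 2)) (normrM ((1 - phi y) / 2)) (ger0_norm q1) (ger0_norm q2).
  have e1 := ler_wpM2l q1 dm; have e2 := ler_wpM2l q2 dp.
  have yx : 0 <= (y - x) / d by rewrite divr_ge0 ?subr_ge0// ltW.
  have -> : 4 * d^-1 * (y - x) = 4 * ((y - x) / d) by ring.
  have f1 : 2 * (y - x) / d = 2 * ((y - x) / d) by ring.
  rewrite f1 in e1 e2; nra.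
rewrite normrM mulrC; apply: ler_wpM2r => //.
rewrite normrM (ger0_norm (_ : 0 <= 2^-1)) ?invr_ge0//.
have := ler_normB l2 l4; lra.
Qed.

Lemma dual_value0 : dual_value 0 z 0 = 0.
Proof.
rewrite /dual_value /relax mulr0 oppr0 expR0 !addr0 !mul1r.
have /andP[z2 z3] : -1 < z < 1 by rewrite -ltr_norml.
rewrite -lnM ?posrE; try lra.
by rewrite (_ : (1 - z) * (1 + z) = 1 - z ^+ 2); [lra|ring].
Qed.

(** Integrate the Fenchel inequality along the path; the boundary term at time t
    vanishes because the path ends at 0. *)
Lemma cost_ge_dual_value J m : 0 < t -> `|m| <= 1 ->
  ((I_S J m + dual_value t z m)%:E <= cost J t 0 m)%E.
Proof.
move=> t0 m1; apply: le_ereal_inf_tmp => _ [phi [[_ phi1] [phi0 phit]] <-].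
rewrite /action; case: ifPn => [/asboolP acphi|_]; last by rewrite leey.
have {}phi1 s : 0 <= s <= t -> `|phi s| <= 1.
  by move=> /phi1; rewrite ler_norml.
rewrite phi0 EFinD leeD2l//.
(* Outside [0, t] the path may leave [-1, 1], where the Lagrangian can be
   negative. *)
pose h s := if 0 <= s <= t then lagrangian (phi s) (derive1 phi s) else 0%E.
rewrite (_ : (\int[mu]_(s in _) _)%E = \int[mu]_(s in `[0%R, t]) h s)%E; last first.
  by apply: eq_integral => s; rewrite inE/= in_itv/= /h => ->.
have acpsi := ac_dual_value t0 acphi phi1.
have -> : dual_value t z m =
    (fun s => - dual_value (t - s) z (phi s)) t -
    (fun s => - dual_value (t - s) z (phi s)) 0.
  by rewrite /= phit phi0 subrr subr0 dual_value0 opprK oppr0 add0r.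
apply: (ac_integral_ge t0 acpsi).
  by move=> s; rewrite /h; case: ifPn => // /phi1/lagrangian_ge0.
(* Where phi is not differentiable its formal derivative is arbitrary, but such
   points form a null set. *)
have [g [_ _ aeg]] := ac_derivative t0 acphi.
apply: filterS aeg; first exact: (ae_filter_ringOfSetsType mu).
move=> s dg s0t _.
have {}dg := dg s0t; move: s0t => /andP[s0 st].
have dpsi := is_derive_dual_value (ltW st) dg.
rewrite derive1E (@derive_val _ _ _ _ _ _ _ dpsi).
rewrite /h (ltW s0) (ltW st)/= derive1E (@derive_val _ _ _ _ _ _ _ dg).
apply: legendre_bound_lagrangian; first by apply: phi1; rewrite (ltW s0) (ltW st).
have [//||b1 b2 _ _] := @relax_bound (t - s) z (1 - `|z|).
- by rewrite subr_ge0 ltW.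
- by rewrite opprB addrC subrK.
have d0 : 0 < 1 - `|z| by rewrite subr_gt0.
by apply: divr_gt0; [exact: lt_le_trans b1|exact: lt_le_trans b2].
Qed.

End cost_bounds.

(** * Hyperbolic functions and the optimal path *)

Section hyperbolic.
Context {R : realType}.
Implicit Types x : R.

Lemma sinhE x : sinh x = ((relax (x / 2))^-1 - relax (x / 2)) / 2.
Proof.
by rewrite /sinh /relax (_ : 2 * (x / 2) = x) ?expRN ?invrK//; field.
Qed.

Lemma coshE x : cosh x = ((relax (x / 2))^-1 + relax (x / 2)) / 2.
Proof.
by rewrite /cosh /relax (_ : 2 * (x / 2) = x) ?expRN ?invrK//; field.
Qed.

Lemma is_derive_sinh x : is_derive x 1 sinh (cosh x).
Proof.
rewrite /sinh /cosh; derive_auto; ring.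
Qed.

Lemma is_derive_cosh x : is_derive x 1 cosh (sinh x).
Proof. rewrite /sinh /cosh; derive_auto; ring. Qed.

Lemma sinh0 : sinh 0 = 0 :> R.
Proof. by rewrite /sinh oppr0 subrr mul0r. Qed.

Lemma cosh0 : cosh 0 = 1 :> R.
Proof. by rewrite /cosh oppr0 expR0; field. Qed.

Lemma cosh_gt0 x : 0 < cosh x.
Proof. by rewrite /cosh divr_gt0// addr_gt0// expR_gt0. Qed.

Lemma cosh2_sinh2 x : cosh x ^+ 2 - sinh x ^+ 2 = 1.
Proof.
rewrite sinhE coshE; have := relax_gt0 (x / 2); move: (relax _) => e e0.
by field; rewrite lt0r_neq0.
Qed.

Lemma sinh_lt x y : x < y -> sinh x < sinh y.
Proof.
move=> xy; rewrite /sinh ltr_pM2r ?invr_gt0//.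
by apply: ltrB; rewrite ltr_expR//; lra.
Qed.

Lemma sinh_le x y : x <= y -> sinh x <= sinh y.
Proof. by rewrite le_eqVlt => /orP[/eqP->//|/sinh_lt/ltW]. Qed.

Lemma sinh_gt0 x : 0 < x -> 0 < sinh x.
Proof. by move=> /sinh_lt; rewrite sinh0. Qed.

Lemma sinhB x y : sinh (x - y) = sinh x * cosh y - cosh x * sinh y.
Proof. by rewrite /sinh /cosh opprB !expRD; field. Qed.

Lemma sinh_double x : sinh (2 * x) = 2 * sinh x * cosh x.
Proof.
rewrite /sinh /cosh (_ : 2 * x = x + x); last by ring.
by rewrite opprD !expRD; field.
Qed.

Lemma cosh_double x : cosh (2 * x) = cosh x ^+ 2 + sinh x ^+ 2.
Proof.
rewrite /sinh /cosh (_ : 2 * x = x + x); last by ring.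
by rewrite opprD !expRD; field.
Qed.

Lemma sinh_lt_cosh x : sinh x < cosh x.
Proof. by rewrite /sinh /cosh; have := expR_gt0 (- x); lra. Qed.

Lemma is_derive_sinh_lin (c m : R) : is_derive m 1 (fun m => sinh (c * m)) (c * cosh (c * m)).
Proof. by rewrite /sinh /cosh; derive_auto; field. Qed.

Lemma is_derive_cosh_lin (c m : R) : is_derive m 1 (fun m => cosh (c * m)) (c * sinh (c * m)).
Proof. by rewrite /sinh /cosh; derive_auto; field. Qed.

End hyperbolic.

Ltac derive_hyp := derive_by ltac:(first
  [ notypeclasses refine (is_derive_sinh_lin _ _)
  | notypeclasses refine (is_derive_cosh_lin _ _) ]).

Section attained.
Context {R : realType}.
Notation mu := (@lebesgue_measure R).
Implicit Types (J t z m s : R).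

(** Equality in the Fenchel inequality holds along phi(s) = sinh (2 (t - s))
    theta, for which the momentum in [is_derive_dual_value] is the one conjugate
    to the velocity. *)
Lemma cost_le_dual_value J t z m : 0 < t -> `|z| < 1 ->
  m = sinh (2 * t) * (2 * z / (1 - z ^+ 2)) -> `|m| < 1 ->
  (cost J t 0 m <= (I_S J m + dual_value t z m)%:E)%E.
Proof.
move=> t0 z1 mE m1; set theta := 2 * z / (1 - z ^+ 2) in mE.
have z2 : 0 < 1 - z ^+ 2 by move: z1; rewrite ltr_norml => /andP[]; nra.
pose phi s := sinh (2 * (t - s)) * theta.
pose v s := - (2 * cosh (2 * (t - s))) * theta.
have dphi s : is_derive s 1 phi (v s).
  rewrite /phi /v /sinh /cosh; derive_auto; ring.
have phi0 : phi 0 = m by rewrite /phi subr0.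
have phit : phi t = 0 by rewrite /phi subrr mulr0 sinh0 mul0r.
have phi1 s : 0 <= s <= t -> `|phi s| < 1.
  move=> /andP[s0 st]; apply: le_lt_trans m1.
  have h1 : sinh (2 * (t - s)) <= sinh (2 * t) by apply: sinh_le; lra.
  have h2 : 0 <= sinh (2 * (t - s)) by rewrite -sinh0; apply: sinh_le; lra.
  have h3 := le_trans h2 h1.
  by rewrite mE /phi !(normrM _ theta) ler_wpM2r// (ger0_norm h2) (ger0_norm h3).
have cphi s : {for s, continuous phi} by exact: derive_continuous (dphi s).
have acphi : absolutely_continuous 0 t phi.
  apply: (@ac_lipschitz _ _ _ (2 * cosh (2 * t) * `|theta|)).
    by rewrite mulr_ge0// mulr_ge0// ltW// cosh_gt0.
  move=> x y x0 xy yt.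
  have cs : {within `[x, y], continuous phi}.
    by apply: continuous_subspaceT => s; exact: cphi.
  have [c + ->] := @MVT_segment R phi v x y xy (fun s _ => dphi s) cs.
  rewrite in_itv/= => /andP[xc cy].
  rewrite normrM (ger0_norm (_ : 0 <= y - x)) ?subr_ge0// ler_wpM2r ?subr_ge0//.
  rewrite /v (normrM _ theta) normrN ler_wpM2r// ger0_norm; last first.
    by rewrite mulr_ge0// ltW// cosh_gt0.
  rewrite ler_pM2l//.
  have h1 := cosh2_sinh2 (2 * (t - c)); have h2 := cosh2_sinh2 (2 * t).
  have h3 : sinh (2 * (t - c)) <= sinh (2 * t) by apply: sinh_le; lra.
  have h4 : 0 <= sinh (2 * (t - c)) by rewrite -sinh0; apply: sinh_le; lra.
  have h5 := cosh_gt0 (2 * (t - c)); have h6 := cosh_gt0 (2 * t).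
  nra.
have dom : (paths t phi /\ phi 0 = m /\ phi t = 0).
  split=> //; split.
    split=> s _; first by apply: cvg_at_right_filter; exact: cphi.
    by apply/cvg_ex; exists (phi s); apply: cvg_at_left_filter; exact: cphi.
  by move=> s /phi1/ltW; rewrite ler_norml.
apply: (@le_trans _ _ (action J t phi)).
  by apply: ereal_inf_lbound; exists phi.
rewrite /action ifT; last exact/asboolP.
rewrite phi0 (EFinD (I_S J m)) leeD2l//.
pose ratio s := (1 - relax (t - s) * z) / (1 + relax (t - s) * z).
pose f s := legendre_bound (phi s) (v s) (ratio s).
have pos s : s <= t -> 0 < 1 - relax (t - s) * z /\ 0 < 1 + relax (t - s) * z.
  move=> st; have d0 : 0 < 1 - `|z| by rewrite subr_gt0.
  have [||b1 b2 _ _] := @relax_bound R (t - s) z (1 - `|z|).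
  - by rewrite subr_ge0.
  - by rewrite opprB addrC subrK.
  - by split; [exact: lt_le_trans b1|exact: lt_le_trans b2].
(* The velocity of phi is dH/dp at the momentum of the dual function. *)
have mom s : s <= t -> v s = (1 - phi s) * ratio s - (1 + phi s) / ratio s.
  move=> st; have [p1 p2] := pos s st.
  rewrite /v /phi /ratio /theta sinhE coshE.
  rewrite (_ : 2 * (t - s) / 2 = t - s); last by field.
  move: (relax _) (relax_gt0 (t - s)) p1 p2 => e e0 p1 p2.
  by field; rewrite !lt0r_neq0.
have lagE s : 0 <= s <= t -> lagrangian (phi s) (derive1 phi s) = (f s)%:E.
  move=> s0t; rewrite /lagrangian phi1// derive1E (@derive_val _ _ _ _ _ _ _ (dphi s)).
  move: s0t => /andP[s0 st]; have [p1 p2] := pos s st.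
  rewrite (@lagrangian_int_momentum _ _ _ (ratio s))//; last exact: mom.
  - by apply: phi1; rewrite s0.
  - by rewrite divr_gt0.
rewrite (_ : (\int[mu]_(s in _) _)%E = \int[mu]_(s in `[0%R, t]) (f s)%:E)%E; last first.
  by apply: eq_integral => s; rewrite inE/= in_itv/= => /lagE.
have dpsi s : s <= t -> is_derive s 1 (fun s => - dual_value (t - s) z (phi s)) (f s).
  by move=> st; exact: is_derive_dual_value.
rewrite (@continuous_FTC2 _ f (fun s => - dual_value (t - s) z (phi s)))//.
- rewrite phit phi0 subrr subr0 -EFinB lee_fin.
  by rewrite (dual_value0 z1) oppr0 add0r opprK.
- apply: continuous_in_subspaceT => s; rewrite inE/= in_itv/= => /andP[s0 st].
  have [p1 p2] := pos s st.
  have : exists d, is_derive s 1 f d; last by move=> [d]; exact: derive_continuous.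
  { eexists; rewrite /f /legendre_bound /v /cosh /ratio.
  repeat first [notypeclasses refine (dphi s) |
    notypeclasses refine (is_derive_relax _ _) | derive_step].
  all: cbv beta; first [exact: lt0r_neq0 | exact: divr_gt0 |
    apply: lt0r_neq0; exact: divr_gt0]. }
- split.
  + move=> s; rewrite in_itv => /andP[s0 st].
    exact: (@ex_derive _ _ _ _ _ _ _ (dpsi s (ltW st))).
  + by apply: cvg_at_right_filter; exact: (derive_continuous (dpsi 0 (ltW t0))).
  + by apply: cvg_at_left_filter; exact: (derive_continuous (dpsi t (lexx t))).
- move=> s; rewrite in_itv => /andP[s0 st].
  by rewrite derive1E (@derive_val _ _ _ _ _ _ _ (dpsi s (ltW st))).
Qed.

End attained.

(** * Sign patterns and the function a^J(m) / m *)

Section signs.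
Context {R : realType}.
Implicit Types (f df : R -> R) (x y : R).

(** Once f is nonpositive it is negative for ever after, which is the sign
    pattern plus-then-minus (either part may be missing) in a form that is
    inherited by primitives. *)
Definition negative_after f := forall x y, 0 < x -> x < y -> f x <= 0 -> f y < 0.

Lemma mean_value f df x y : x < y -> (forall u, x <= u <= y -> is_derive u 1 f (df u)) ->
  exists2 c, x < c < y & f y - f x = df c * (y - x).
Proof.
move=> xy dfx.
have cf : {within `[x, y], continuous f}.
  apply: continuous_in_subspaceT => s; rewrite inE/= in_itv => sxy.
  exact: derive_continuous (dfx s sxy).
have dfo : forall u, u \in `]x, y[%R -> is_derive u 1 f (df u).
  by move=> u; rewrite in_itv/= => /andP[xu uy]; apply: dfx; rewrite !ltW.
have [c] := MVT xy dfo cf; rewrite in_itv/= => cxy e.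
by exists c.
Qed.

Lemma derive_lt f df x y : x < y -> (forall u, x <= u <= y -> is_derive u 1 f (df u)) ->
  (forall u, x < u < y -> 0 < df u) -> f x < f y.
Proof.
move=> xy dfx df0; have [c cxy e] := mean_value xy dfx.
by rewrite -subr_gt0 e mulr_gt0 ?subr_gt0 ?df0.
Qed.

Lemma derive_gt f df x y : x < y -> (forall u, x <= u <= y -> is_derive u 1 f (df u)) ->
  (forall u, x < u < y -> df u < 0) -> f y < f x.
Proof.
move=> xy dfx df0; have [c cxy e] := mean_value xy dfx.
by rewrite -subr_lt0 e nmulr_rlt0 ?subr_gt0 ?df0.
Qed.

(** If f x <= 0 <= f 0 then f has a nonpositive slope somewhere before x, hence
    negative slopes from there on. *)
Lemma negative_after_primitive f df : 0 <= f 0 ->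
  (forall x, 0 <= x -> is_derive x 1 f (df x)) -> negative_after df ->
  negative_after f.
Proof.
move=> f0 dfx ndf x y x0 xy fx.
have [c /andP[c0 cx] e] := mean_value x0 (fun u (h : 0 <= u <= x) => dfx u (proj1 (andP h))).
have dc : df c <= 0.
  by rewrite leNgt; apply/negP => dc; have := mulr_gt0 dc (_ : 0 < x - 0); rewrite -e; lra.
apply: lt_le_trans fx; apply: (derive_gt xy).
  by move=> u /andP[xu _]; apply: dfx; lra.
by move=> u /andP[xu _]; apply: (ndf c) => //; lra.
Qed.

Lemma positive_near0 f (d : R) : f 0 = 0 -> is_derive (0 : R) 1 f d -> 0 < d ->
  exists2 e, 0 < e & forall x, 0 < x < e -> 0 < f x.
Proof.
move=> f0 df d0.
have [/cvg_ex[l hl] dv] := df.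
have hd : h^-1 *: (f (h%:A + 0) - f 0) @[h --> 0^'] --> d.
  by rewrite -dv; apply/cvg_ex; exists l.
have : \forall h \near (0 : R)^', 0 < h^-1 *: (f (h%:A + 0) - f 0).
  by apply: (cvgr_gt _ hd).
rewrite /dnbhs/within/= => /nbhs_ballP[e /= e0 he].
exists e => // x /andP[x0 xe].
have := he x; rewrite /ball/= sub0r normrN gtr0_norm// => /(_ xe (lt0r_neq0 x0)).
by rewrite f0 subr0 addr0 [x%:A]mulr1 -[_ *: _]/(_ * _) pmulr_rgt0 ?invr_gt0.
Qed.

End signs.

Section coth_time.
Context {R : realType}.
Implicit Types (J m x y : R).

(** coth (2 t(m)), where t(m) is the time at which m is a critical point. *)
Definition coth_time J m : R := a_J J m / m.

(** m^2 times the derivative of a^J(m) / m. *)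
Definition coth_time_num J m : R :=
  2 * J * m * cosh (2 * J * m) - sinh (2 * J * m) - 2 * J * m ^+ 2 * sinh (2 * J * m).

(** Up to positive factors [q J] is the derivative of [coth_time_num J], and [r J] that of
    [q J]. *)
Let q J m : R := (2 * J - 2) * sinh (2 * J * m) - 2 * J * m * cosh (2 * J * m).
Let r J m : R := (2 * J - 3) * cosh (2 * J * m) - 2 * J * m * sinh (2 * J * m).

Lemma is_derive_coth_time J m : m != 0 -> is_derive m 1 (coth_time J) (coth_time_num J m / m ^+ 2).
Proof.
move=> m0; rewrite /coth_time /a_J /coth_time_num; derive_hyp => //.
by field.
Qed.

Lemma is_derive_coth_time_num J m : is_derive m 1 (coth_time_num J) (2 * J * m * q J m).
Proof. by rewrite /coth_time_num /q; derive_hyp; ring. Qed.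

Lemma is_derive_q J m : is_derive m 1 (q J) (2 * J * r J m).
Proof. by rewrite /q /r; derive_hyp; ring. Qed.

(** r J / cosh is 2J - 3 minus the increasing function 2J m tanh (2J m); the
    quotient is avoided through the addition formula for sinh (2J y - 2J x). *)
Lemma negative_after_r J : 0 < J -> negative_after (r J).
Proof.
move=> J0 x y x0 xy; rewrite /r => rx.
have cx := cosh_gt0 (2 * J * x); have cy := cosh_gt0 (2 * J * y).
have sx : 0 < sinh (2 * J * x) by apply: sinh_gt0; rewrite !mulr_gt0.
have sy : 0 < sinh (2 * J * y) by apply: sinh_gt0; rewrite !mulr_gt0//; lra.
have sxy : 0 < sinh (2 * J * y - 2 * J * x).
  by apply: sinh_gt0; rewrite -mulrBr mulr_gt0 ?mulr_gt0//; lra.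
rewrite sinhB in sxy.
move: sxy rx cx cy sx sy; move: (cosh (2 * J * x)) (cosh (2 * J * y)) (sinh (2 * J * x)) (sinh (2 * J * y)).
move=> c1 c2 s1 s2 sxy rx cx cy sx sy.
suff : c1 * ((2 * J - 3) * c2 - 2 * J * y * s2) < 0 by rewrite pmulr_rlt0.
have h1 : ((2 * J - 3) * c1 - 2 * J * x * s1) * c2 <= 0 by rewrite pmulr_lle0.
have h2 : 0 < 2 * J * x * (s2 * c1 - c2 * s1) by rewrite !mulr_gt0.
have h3 : 0 < 2 * J * (y - x) * (s2 * c1) by rewrite !mulr_gt0//; lra.
lra.
Qed.

Lemma negative_after_q J : 0 < J -> negative_after (q J).
Proof.
move=> J0; apply: (negative_after_primitive (df := fun m => 2 * J * r J m)).
- by rewrite /q !mulr0 sinh0 !mulr0 !mul0r subr0.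
- by move=> x _; exact: is_derive_q.
- move=> x y x0 xy; rewrite pmulr_rle0 ?mulr_gt0// pmulr_rlt0 ?mulr_gt0//.
  exact: negative_after_r.
Qed.

Lemma negative_after_coth_time_num J : 0 < J -> negative_after (coth_time_num J).
Proof.
move=> J0; apply: (negative_after_primitive (df := fun m => 2 * J * m * q J m)).
- by rewrite /coth_time_num !mulr0 sinh0 expr0n/= !mulr0 !mul0r !subr0.
- by move=> x _; exact: is_derive_coth_time_num.
- move=> x y x0 xy; have y0 : 0 < y by lra.
  rewrite pmulr_rle0 ?mulr_gt0// pmulr_rlt0 ?mulr_gt0//.
  exact: negative_after_q.
Qed.

Lemma coth_time_decr_after J x y z : 0 < J -> 0 < x -> coth_time_num J x <= 0 -> x <= y -> y < z ->
  coth_time J z < coth_time J y.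
Proof.
move=> J0 x0 nx xy yz; apply: (@derive_gt _ (coth_time J) (fun u => coth_time_num J u / u ^+ 2) _ _ yz).
  by move=> u /andP[yu _]; apply: is_derive_coth_time; rewrite gt_eqF//; lra.
move=> u /andP[yu _]; have u0 : 0 < u by lra.
rewrite pmulr_llt0 ?invr_gt0 ?exprn_gt0//.
by apply: (negative_after_coth_time_num J0 x0) => //; lra.
Qed.

(** No increase after a nonincrease: between x and y the derivative is somewhere
    nonpositive, hence negative afterwards. *)
Lemma coth_time_unimodal J x y z : 0 < J -> 0 < x -> x < y -> coth_time J y <= coth_time J x ->
  y < z -> coth_time J z < coth_time J y.
Proof.
move=> J0 x0 xy kxy yz.
have dk u : x <= u <= y -> is_derive u 1 (coth_time J) (coth_time_num J u / u ^+ 2).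
  by move=> /andP[xu _]; apply: is_derive_coth_time; rewrite gt_eqF//; lra.
have [c /andP[xc cy] e] := mean_value xy dk.
have c0 : 0 < c by lra.
apply: (@coth_time_decr_after _ c) => //; last by lra.
rewrite leNgt; apply/negP => nc.
have : 0 < coth_time_num J c / c ^+ 2 * (y - x).
  by rewrite mulr_gt0 ?subr_gt0// divr_gt0// exprn_gt0.
by rewrite -e; lra.
Qed.

Lemma r_lt0 J m : 0 < J -> J <= 3 / 2 -> 0 < m -> r J m < 0.
Proof.
move=> J0 J1 m0; rewrite /r.
have c0 := cosh_gt0 (2 * J * m).
have s0 : 0 < sinh (2 * J * m) by apply: sinh_gt0; rewrite !mulr_gt0.
have h : 0 < 2 * J * m * sinh (2 * J * m) by rewrite mulr_gt0// !mulr_gt0.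
have h2 : 0 <= (3 - 2 * J) * cosh (2 * J * m) by apply: mulr_ge0; lra.
lra.
Qed.

Lemma q_lt0 J m : 0 < J -> J <= 3 / 2 -> 0 < m -> q J m < 0.
Proof.
move=> J0 J1 m0; have -> : 0 = q J 0 by rewrite /q !mulr0 sinh0 !mulr0 !mul0r subr0.
apply: (@derive_gt _ (q J) (fun u => 2 * J * r J u) _ _ m0).
  by move=> u _; exact: is_derive_q.
by move=> u /andP[u0 _]; rewrite pmulr_rlt0 ?mulr_gt0// r_lt0.
Qed.

Lemma coth_time_num_lt0 J m : 0 < J -> J <= 3 / 2 -> 0 < m -> coth_time_num J m < 0.
Proof.
move=> J0 J1 m0.
have -> : 0 = coth_time_num J 0 by rewrite /coth_time_num !mulr0 sinh0 expr0n/= !mulr0 !mul0r !subr0.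
apply: (@derive_gt _ (coth_time_num J) (fun u => 2 * J * u * q J u) _ _ m0).
  by move=> u _; exact: is_derive_coth_time_num.
by move=> u /andP[u0 _]; rewrite pmulr_rlt0 ?mulr_gt0// q_lt0.
Qed.

Lemma coth_time_decr J x y : 0 < J -> J <= 3 / 2 -> 0 < x -> x < y -> coth_time J y < coth_time J x.
Proof.
move=> J0 J1 x0 xy; apply: (@coth_time_decr_after _ x x) => //.
by apply/ltW/coth_time_num_lt0.
Qed.

(** 2J - 1 is the limit at 0. *)
Lemma coth_time_lt_limit J m : 0 < J -> J <= 3 / 2 -> 0 < m -> coth_time J m < 2 * J - 1.
Proof.
move=> J0 J1 m0.
pose f m := a_J J m - (2 * J - 1) * m.
pose g m := (2 * J - 1) * (cosh (2 * J * m) - 1) - 2 * J * m * sinh (2 * J * m).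
have df (u : R) : is_derive u 1 f (g u) by rewrite /f /g /a_J; derive_hyp; ring.
have dg (u : R) : is_derive u 1 g (2 * J * q J u) by rewrite /g /q; derive_hyp; ring.
have g0 u : 0 < u -> g u < 0.
  move=> u0; have -> : 0 = g 0 by rewrite /g !mulr0 cosh0 subrr mulr0 mul0r subr0.
  apply: (@derive_gt _ g (fun u => 2 * J * q J u) _ _ u0) => // w /andP[w0 _].
  by rewrite pmulr_rlt0 ?mulr_gt0// q_lt0.
have f0 : f m < 0.
  have -> : 0 = f 0 by rewrite /f /a_J !mulr0 sinh0 mul0r !subr0.
  by apply: (@derive_gt _ f g _ _ m0) => // w /andP[w0 _]; exact: g0.
by rewrite /coth_time ltr_pdivrMr//; move: f0; rewrite /f; lra.
Qed.

Lemma coth_time_gt_near0 J c : c < 2 * J - 1 ->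
  exists2 e, 0 < e & forall m, 0 < m < e -> c < coth_time J m.
Proof.
move=> cJ; pose f m := a_J J m - c * m.
have df : is_derive (0 : R) 1 f (2 * J - 1 - c).
  rewrite /f /a_J; derive_hyp; rewrite !mulr0 sinh0 cosh0; ring.
have f0 : f 0 = 0 by rewrite /f /a_J !mulr0 sinh0 mul0r !subr0.
have [e e0 he] := positive_near0 f0 df ltac:(lra).
exists e => // m /andP[m0 me].
rewrite /coth_time ltr_pdivlMr//; have := he m; rewrite m0 me => /(_ isT); rewrite /f; lra.
Qed.

Lemma coth_time1_lt0 J : coth_time J 1 < 0.
Proof.
by rewrite /coth_time /a_J divr1 mul1r mulr1; have := sinh_lt_cosh (2 * J); lra.
Qed.

Lemma coth_time_incrJ J1 J2 m : J1 < J2 -> 0 < m < 1 -> coth_time J1 m < coth_time J2 m.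
Proof.
move=> J12 /andP[m0 m1].
rewrite /coth_time ltr_pM2r ?invr_gt0// /a_J.
pose f J := sinh (2 * m * J) - m * cosh (2 * m * J).
have fE J : sinh (2 * J * m) - m * cosh (2 * J * m) = f J.
  by rewrite /f; congr (sinh _ - m * cosh _); ring.
rewrite !fE.
have df (u : R) : is_derive u 1 f (2 * m * (cosh (2 * m * u) - m * sinh (2 * m * u))).
  by rewrite /f; derive_hyp; ring.
apply: (@derive_lt _ f _ _ _ J12 (fun u _ => df u)) => u _; rewrite mulr_gt0 ?mulr_gt0//.
have h1 := sinh_lt_cosh (2 * m * u); have h2 := cosh_gt0 (2 * m * u).
by have [s0|s0] := leP (sinh (2 * m * u)) 0; nra.
Qed.

Lemma coth_time_num_gt0_near0 J : 3 / 2 < J ->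
  exists2 e, 0 < e & forall m, 0 < m < e -> 0 < coth_time_num J m.
Proof.
move=> J1; have J0 : 0 < J by lra.
have q0 : q J 0 = 0 by rewrite /q !mulr0 sinh0 !mulr0 !mul0r subr0.
have dq := is_derive_q J 0.
have d0 : 0 < 2 * J * r J 0.
  by rewrite /r !mulr0 cosh0 mul0r subr0 mulr1 !mulr_gt0//; lra.
have [e e0 he] := positive_near0 q0 dq d0.
exists e => // m /andP[m0 me].
have -> : 0 = coth_time_num J 0 by rewrite /coth_time_num !mulr0 sinh0 expr0n/= !mulr0 !mul0r !subr0.
apply: (@derive_lt _ (coth_time_num J) (fun u => 2 * J * u * q J u) _ _ m0).
  by move=> u _; exact: is_derive_coth_time_num.
by move=> u /andP[u0 um]; rewrite mulr_gt0 ?mulr_gt0// he// u0/=; lra.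
Qed.

End coth_time.

(** * The function C_M and its zero *)

Section tanh.
Context {R : realType}.
Implicit Types (x y m J : R).

Lemma is_derive_tanh x : is_derive x 1 tanh (cosh x ^+ 2)^-1.
Proof.
have c0 := cosh_gt0 x.
rewrite /tanh; derive_by ltac:(first [notypeclasses refine (is_derive_sinh _)
   | notypeclasses refine (is_derive_cosh _)]); first by rewrite gt_eqF.
have := cosh2_sinh2 x; move: c0; move: (cosh x) (sinh x) => c s c0 cs.
rewrite [RHS](_ : _ = (c ^+ 2 - s ^+ 2) * (c ^+ 2)^-1); last by rewrite cs mul1r.
field.
by rewrite gt_eqF.
Qed.

Lemma tanh_lt x y : x < y -> tanh x < tanh y.
Proof.
move=> xy; apply: (@derive_lt _ tanh (fun x => (cosh x ^+ 2)^-1) _ _ xy).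
  by move=> u _; exact: is_derive_tanh.
by move=> u _; rewrite invr_gt0 exprn_gt0// cosh_gt0.
Qed.

Lemma tanh_lt1 x : tanh x < 1.
Proof. by rewrite /tanh ltr_pdivrMr ?cosh_gt0// mul1r sinh_lt_cosh. Qed.

Lemma tanh_gt0 x : 0 < x -> 0 < tanh x.
Proof. by move=> x0; rewrite /tanh divr_gt0 ?cosh_gt0 ?sinh_gt0. Qed.

Lemma tanh_ge0 x : 0 <= x -> 0 <= tanh x.
Proof. by rewrite le_eqVlt => /orP[/eqP<-|/tanh_gt0/ltW//]; rewrite /tanh sinh0 mul0r. Qed.

Lemma cosh_gt1 x : x != 0 -> 1 < cosh x.
Proof.
move=> x0; have c0 := cosh_gt0 x; have := cosh2_sinh2 x.
have s0 : 0 < sinh x ^+ 2.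
  rewrite exprn_even_gt0//=; case: (ltgtP x 0) x0 => // [x0 _|x0 _].
    by rewrite lt_eqF// -sinh0 sinh_lt.
  by rewrite gt_eqF// sinh_gt0.
by move=> h; rewrite ltNge; apply/negP => c1; nra.
Qed.

Lemma one_sub_mtanh_gt0 m x : 0 <= m <= 1 -> 0 <= x -> 0 < 1 - m * tanh x.
Proof.
by move=> /andP[m0 m1] x0; have := tanh_lt1 x; have := tanh_ge0 x0; nra.
Qed.

End tanh.

Section CM.
Context {R : realType}.
Implicit Types (x y m J : R).

(** The derivative has the sign of that of a^J(m) / m: at fixed t the derivative
    in m vanishes at critical points, so that C_M moves with the critical time
    only. *)
Lemma is_derive_C_M J m : 0 < J -> 0 <= m <= 1 ->
  is_derive m 1 (C_M J) (coth_time_num J m / (4 * cosh (J * m) ^+ 2 * (1 - m * tanh (J * m)))).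
Proof.
move=> J0 m01; have /andP[m0 m1] := m01.
have d0 := @one_sub_mtanh_gt0 _ m (J * m) m01 (mulr_ge0 (ltW J0) m0).
have dt : is_derive m 1 (fun m => tanh (J * m)) ((cosh (J * m) ^+ 2)^-1 * J).
  by have := der_comp (is_derive_tanh (J * m)) (der_scale J (der_id m)); rewrite mulr1.
rewrite /C_M; derive_by ltac:(notypeclasses refine dt) => //.
rewrite /coth_time_num -(mulrA 2 J m) sinh_double cosh_double.
move: d0; rewrite /tanh.
have := cosh2_sinh2 (J * m); have := cosh_gt0 (J * m).
move: (cosh (J * m)) (sinh (J * m)) => c s c0 cs d0.
have d1 : 0 < c - m * s.
  by have := mulr_gt0 d0 c0; rewrite mulrBl mul1r -mulrA divfK// gt_eqF.
have e1 : J * m = J * m * (c ^+ 2 - s ^+ 2) by rewrite cs mulr1.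
have c00 : c != 0 by rewrite gt_eqF.
have d10 : c - m * s != 0 by rewrite gt_eqF.
have -> : 1 - m * (s / c) = (c - m * s) / c by field.
(* [field] does not know that cosh^2 - sinh^2 = 1. *)
have -> : (c ^+ 2)^-1 * J = (c ^+ 2 - s ^+ 2) * (c ^+ 2)^-1 * J.
  by rewrite cs mul1r.
field.
by rewrite c00 d10.
Qed.

Lemma C_M0 J : C_M J 0 = 0.
Proof. by rewrite /C_M expr0n/= !mul0r mulr0 !mul0r subr0 ln1 mul0r addr0. Qed.

Lemma C_M_derivative_den_gt0 J m : 0 < J -> 0 <= m <= 1 ->
  0 < 4 * cosh (J * m) ^+ 2 * (1 - m * tanh (J * m)).
Proof.
move=> J0 m01; have /andP[m0 m1] := m01.
apply: mulr_gt0; last exact: one_sub_mtanh_gt0 (mulr_ge0 (ltW J0) m0).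
by apply: mulr_gt0 => //; apply: exprn_gt0; exact: cosh_gt0.
Qed.

(** C_M has come back to 0 or below, so it has decreased before x. *)
Lemma coth_time_num_lt0_of_C_M J x : 0 < J -> 0 < x <= 1 -> C_M J x <= 0 -> coth_time_num J x < 0.
Proof.
move=> J0 /andP[x0 x1] Cx.
have dC u : 0 <= u <= x -> is_derive u 1 (C_M J)
    (coth_time_num J u / (4 * cosh (J * u) ^+ 2 * (1 - u * tanh (J * u)))).
  by move=> /andP[u0 ux]; apply: is_derive_C_M => //; rewrite u0 (le_trans ux).
have [c /andP[c0 cx] e] := mean_value x0 dC.
apply: (negative_after_coth_time_num J0 c0 cx); rewrite leNgt; apply/negP => nc.
have : 0 < coth_time_num J c / (4 * cosh (J * c) ^+ 2 * (1 - c * tanh (J * c))) * (x - 0).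
  apply: mulr_gt0; last by rewrite subr0.
  by apply: divr_gt0 => //; apply: C_M_derivative_den_gt0; rewrite // (ltW c0) (le_trans (ltW cx)).
by rewrite -e C_M0 subr0 ltNge Cx.
Qed.

Lemma C_M_neg_after J x y : 0 < J -> 0 < x -> x < y -> y <= 1 -> C_M J x <= 0 ->
  C_M J y < 0.
Proof.
move=> J0 x0 xy y1 Cx; apply: (lt_le_trans _ Cx).
have nx : coth_time_num J x < 0 by apply: coth_time_num_lt0_of_C_M => //; lra.
apply: (@derive_gt _ _ (fun u => coth_time_num J u / (4 * cosh (J * u) ^+ 2 * (1 - u * tanh (J * u)))) _ _ xy).
  by move=> u /andP[xu uy]; apply: is_derive_C_M => //; lra.
move=> u /andP[xu uy]; rewrite pmulr_llt0.
  by apply: (negative_after_coth_time_num J0 x0) => //; exact: ltW.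
by rewrite invr_gt0; apply: C_M_derivative_den_gt0 => //; lra.
Qed.

(** Equivalent to 1 < cosh J, as 1 - tanh J = exp (- J) / cosh J. *)
Lemma C_M1_lt0 J : 0 < J -> C_M J 1 < 0.
Proof.
move=> J0; rewrite /C_M expr1n !mulr1 mul1r.
have c0 := cosh_gt0 J; have c1 := @cosh_gt1 _ J (lt0r_neq0 J0).
have t1 := tanh_lt1 J.
suff : ln (1 - tanh J) < - J by lra.
rewrite -ltr_expR lnK; last by rewrite posrE subr_gt0.
have -> : 1 - tanh J = expR (- J) / cosh J.
  rewrite /tanh; have -> : expR (- J) = cosh J - sinh J by rewrite /cosh /sinh; field.
  by field; rewrite gt_eqF.
by rewrite ltr_pdivrMr// ltr_pMr// expR_gt0.
Qed.

Lemma C_M_gt0_near0 J : 3 / 2 < J -> exists2 m, 0 < m < 1 & 0 < C_M J m.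
Proof.
move=> J1; have J0 : 0 < J by lra.
have [e e0 he] := coth_time_num_gt0_near0 J1.
pose m := Num.min (e / 2) (1 / 2).
have m0 : 0 < m by rewrite lt_min !divr_gt0.
have me : m < e by rewrite gt_min; apply/orP; left; lra.
have m1 : m < 1 by rewrite gt_min; apply/orP; right; lra.
exists m; first by rewrite m0.
rewrite -(C_M0 J).
apply: (@derive_lt _ _ (fun u => coth_time_num J u / (4 * cosh (J * u) ^+ 2 * (1 - u * tanh (J * u)))) _ _ m0).
  by move=> u /andP[xu uy]; apply: is_derive_C_M => //; lra.
move=> u /andP[u0 um]; apply: divr_gt0.
  by apply: he; rewrite u0 (lt_trans um).
by apply: C_M_derivative_den_gt0 => //; lra.
Qed.

Lemma C_M_continuous J a b : 0 < J -> 0 <= a -> b <= 1 -> {within `[a, b], continuous (C_M J)}.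
Proof.
move=> J0 a0 b1; apply: continuous_in_subspaceT => s; rewrite inE/= in_itv/= => /andP[sa sb].
have s01 : 0 <= s <= 1 by lra.
exact: derive_continuous (is_derive_C_M J0 s01).
Qed.

Lemma m_starP J : 3 / 2 < J -> 0 < m_star J < 1 /\ C_M J (m_star J) = 0.
Proof.
move=> J1; have J0 : 0 < J by lra.
rewrite /m_star; case: xgetP => [m -> //|].
have [m /andP[m0 m1] Cm] := C_M_gt0_near0 J1.
have C1 := C_M1_lt0 J0.
have [|c + Cc] := @IVT _ (C_M J) m 1 0 (ltW m1) (C_M_continuous J0 (ltW m0) (lexx 1)).
  by rewrite ge_min le_max (ltW C1) (ltW Cm) orbT.
rewrite in_itv/= => /andP[mc c1] /(_ c)[]; split => //.
rewrite (lt_le_trans m0 mc)/= lt_neqAle c1 andbT; apply/eqP => cE.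
by move: Cc C1; rewrite cE => ->; rewrite ltxx.
Qed.

Lemma m_star_lt J m : 3 / 2 < J -> 0 < m < 1 -> 0 < C_M J m -> m < m_star J.
Proof.
move=> J1 /andP[m0 m1] Cm; have [/andP[s0 s1] sC] := m_starP J1.
rewrite ltNge; apply/negP; rewrite le_eqVlt => /orP[/eqP sm|sm].
  by move: Cm; rewrite -sm sC ltxx.
have := @C_M_neg_after J (m_star J) m ltac:(lra) s0 sm (ltW m1).
by rewrite sC => /(_ (lexx 0)); lra.
Qed.

Let g m x : R := x * m + ln (1 - m * tanh x).

Let C_ME J m : C_M J m = g m (J * m) / 2.
Proof. by rewrite /C_M /g; ring. Qed.

Let dg m x : 0 < m < 1 -> 0 <= x -> is_derive x 1 (g m)
  (m * (sinh x * (sinh x - m * cosh x)) / (cosh x ^+ 2 * (1 - m * tanh x))).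
Proof.
move=> m01 x0.
have d0 : 0 < 1 - m * tanh x by apply: one_sub_mtanh_gt0 => //; lra.
rewrite /g; derive_by ltac:(notypeclasses refine (is_derive_tanh _)) => //.
move: d0; rewrite /tanh.
have := cosh2_sinh2 x; have := cosh_gt0 x.
move: (cosh x) (sinh x) => c s c0 cs d0.
have c00 : c != 0 by rewrite gt_eqF.
have d1 : c - m * s != 0.
  have := mulr_gt0 d0 c0; rewrite mulrBl mul1r -mulrA divfK// => h.
  by rewrite gt_eqF.
have -> : 1 - m * (s / c) = (c - m * s) / c by field.
have -> : (c ^+ 2)^-1 = (c ^+ 2 - s ^+ 2) * (c ^+ 2)^-1 by rewrite cs mul1r.
field.
by rewrite c00 d1.
Qed.

Let g_den_gt0 m x : 0 < m < 1 -> 0 <= x -> 0 < (cosh x ^+ 2 * (1 - m * tanh x)).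
Proof.
move=> m01 x0; apply: mulr_gt0; first by apply: exprn_gt0; exact: cosh_gt0.
by apply: one_sub_mtanh_gt0 => //; lra.
Qed.

(** As a function of x = J m at fixed m, 2 C_M vanishes at 0 and decreases as
    long as tanh x < m. *)
Lemma C_M_ge0_tanh J m : 0 < J -> 0 < m < 1 -> 0 <= C_M J m -> m < tanh (J * m).
Proof.
move=> J0 m01; have /andP[m0 m1] := m01; rewrite leNgt => /negP Cm.
rewrite ltNge; apply/negP => tm; apply: Cm.
rewrite C_ME pmulr_llt0 ?invr_gt0//.
have Jm0 : 0 < J * m by exact: mulr_gt0.
have -> : 0 = g m 0 by rewrite /g /tanh sinh0 !mul0r mulr0 subr0 ln1 addr0.
apply: (@derive_gt _ _ (fun x => m * (sinh x * (sinh x - m * cosh x)) / (cosh x ^+ 2 * (1 - m * tanh x))) _ _ Jm0).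
  by move=> u /andP[u0 _]; exact: dg.
move=> u /andP[u0 uJ]; rewrite pmulr_llt0; last by rewrite invr_gt0; exact: g_den_gt0 (ltW u0).
rewrite pmulr_rlt0// pmulr_rlt0; last exact: sinh_gt0.
have := lt_le_trans (tanh_lt uJ) tm.
by rewrite /tanh ltr_pdivrMr ?cosh_gt0//; lra.
Qed.

Lemma C_M_incrJ J1 J2 m : 0 < J1 -> J1 < J2 -> 0 < m < 1 -> 0 <= C_M J1 m ->
  C_M J1 m < C_M J2 m.
Proof.
move=> J0 J12 m01 CM; have tm := C_M_ge0_tanh J0 m01 CM; have /andP[m0 m1] := m01.
rewrite !C_ME ltr_pM2r ?invr_gt0//.
have J12m : J1 * m < J2 * m by rewrite ltr_pM2r.
have J1m : 0 < J1 * m by exact: mulr_gt0.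
apply: (@derive_lt _ _ (fun x => m * (sinh x * (sinh x - m * cosh x)) / (cosh x ^+ 2 * (1 - m * tanh x))) _ _ J12m).
  by move=> u /andP[u0 _]; apply: dg => //; lra.
move=> u /andP[u0 uJ]; have u00 : 0 < u by lra.
apply: divr_gt0; last exact: g_den_gt0 (ltW u00).
apply: mulr_gt0 => //; apply: mulr_gt0; first exact: sinh_gt0.
have := lt_trans tm (tanh_lt u0).
by rewrite /tanh ltr_pdivlMr ?cosh_gt0//; lra.
Qed.

Lemma m_star_increasing J1 J2 : 3 / 2 < J1 -> J1 < J2 -> m_star J1 < m_star J2.
Proof.
move=> J1l J12; have [s01 sC] := m_starP J1l.
apply: m_star_lt => //; first exact: lt_trans J12.
rewrite -sC; apply: C_M_incrJ => //; [lra|by rewrite sC].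
Qed.

Lemma coth_time_gt1 J m : 0 < J -> 0 < m < 1 -> m < tanh (J * m) -> 1 < coth_time J m.
Proof.
move=> J0 /andP[m0 m1] tm.
rewrite /coth_time ltr_pdivlMr// mul1r /a_J -(mulrA 2) sinh_double cosh_double.
move: tm; rewrite /tanh ltr_pdivlMr ?cosh_gt0// => tm.
have := cosh2_sinh2 (J * m); have := cosh_gt0 (J * m).
move: (cosh (J * m)) (sinh (J * m)) tm => c s tm c0 cs.
have h : 0 < 2 * c * (s - m * c) by rewrite !mulr_gt0// subr_gt0.
have e : m = m * (c ^+ 2 - s ^+ 2) by rewrite cs mulr1.
rewrite [ltLHS]e; lra.
Qed.

End CM.

(** * The minimal cost of a starting point *)

Section static.
Context {R : realType}.
Implicit Types (J t z m x : R).

Definition coth2 t : R := cosh (2 * t) / sinh (2 * t).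

(** The start of the optimal path with parameter z. *)
Definition start_of t z : R := sinh (2 * t) * (2 * z / (1 - z ^+ 2)).

(** The inverse of [start_of t], for t > 0. *)
Definition dual_param t m : R := m / (sinh (2 * t) + Num.sqrt (sinh (2 * t) ^+ 2 + m ^+ 2)).

Lemma sub_sqr_gt0 z : `|z| < 1 -> 0 < 1 - z ^+ 2.
Proof. by rewrite ltr_norml => /andP[z1 z2]; nra. Qed.

Lemma sinh2t_gt0 t : 0 < t -> 0 < sinh (2 * t).
Proof. by move=> t0; apply: sinh_gt0; lra. Qed.

Lemma coth2_continuous t : 0 < t -> coth2 s @[s --> t] --> coth2 t.
Proof.
move=> t0; have : exists d, is_derive t 1 coth2 d; last by move=> [d]; exact: derive_continuous.
{ eexists; rewrite /coth2; repeat first [notypeclasses refine (is_derive_sinh_lin _ _)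
    | notypeclasses refine (is_derive_cosh_lin _ _) | derive_step].
  all: cbv beta; rewrite gt_eqF// sinh2t_gt0//. }
Qed.

Lemma dual_paramK t m : 0 < t -> `|dual_param t m| < 1 /\ start_of t (dual_param t m) = m.
Proof.
move=> t0; rewrite /dual_param /start_of.
have s0 := sinh2t_gt0 t0; move: (sinh (2 * t)) s0 => s s0.
set r := Num.sqrt _.
have r2 : r ^+ 2 = s ^+ 2 + m ^+ 2 by rewrite sqr_sqrtr// addr_ge0// sqr_ge0.
have r0 : 0 <= r by exact: sqrtr_ge0.
clearbody r.
have sr : 0 < s + r by lra.
have z1 : `|m / (s + r)| < 1.
  rewrite normrM normfV (gtr0_norm sr) ltr_pdivrMr// mul1r ltr_norml.
  by apply/andP; split; nra.
split => //.
have m2 : m ^+ 2 = r ^+ 2 - s ^+ 2 by rewrite r2; ring.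
have e : 1 - (m / (s + r)) ^+ 2 = 2 * s / (s + r).
  have -> : 1 - (m / (s + r)) ^+ 2 = ((s + r) ^+ 2 - m ^+ 2) / (s + r) ^+ 2.
    by field; rewrite gt_eqF.
  by rewrite m2; field; rewrite gt_eqF.
rewrite e; field.
by rewrite !gt_eqF.
Qed.

Lemma start_of_lt t z1 z2 : 0 < t -> `|z1| < 1 -> `|z2| < 1 -> z1 < z2 -> start_of t z1 < start_of t z2.
Proof.
move=> t0 h1 h2 z12; rewrite /start_of ltr_pM2l ?sinh2t_gt0//.
have d1 := sub_sqr_gt0 h1; have d2 := sub_sqr_gt0 h2.
rewrite -subr_gt0.
have -> : 2 * z2 / (1 - z2 ^+ 2) - 2 * z1 / (1 - z1 ^+ 2) =
  2 * (z2 - z1) * (1 + z1 * z2) / ((1 - z1 ^+ 2) * (1 - z2 ^+ 2)).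
  by field; rewrite !gt_eqF.
move: h1 h2; rewrite !ltr_norml => /andP[a1 a2] /andP[b1 b2].
apply: divr_gt0; last exact: mulr_gt0.
by apply: mulr_gt0; [lra|nra].
Qed.

Lemma start_of_inj t z1 z2 : 0 < t -> `|z1| < 1 -> `|z2| < 1 -> start_of t z1 = start_of t z2 -> z1 = z2.
Proof.
move=> t0 h1 h2 e; case: (ltgtP z1 z2) => // [lt|lt].
- by have := start_of_lt t0 h1 h2 lt; rewrite e ltxx.
- by have := start_of_lt t0 h2 h1 lt; rewrite e ltxx.
Qed.

Lemma dual_param_start_of t z : 0 < t -> `|z| < 1 -> dual_param t (start_of t z) = z.
Proof.
by move=> t0 z1; have [h e] := dual_paramK (start_of t z) t0; exact: (start_of_inj t0).
Qed.

Lemma dual_param_lt t m1 m2 : 0 < t -> m1 < m2 -> dual_param t m1 < dual_param t m2.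
Proof.
move=> t0 m12; have [a1 e1] := dual_paramK m1 t0; have [a2 e2] := dual_paramK m2 t0.
rewrite ltNge le_eqVlt; apply/negP => /orP[/eqP e|lt].
  by move: m12; rewrite -e1 -e2 e ltxx.
by have := start_of_lt t0 a2 a1 lt; rewrite e1 e2; lra.
Qed.

Lemma dual_param0 t : dual_param t 0 = 0. Proof. by rewrite /dual_param mul0r. Qed.

Lemma dual_paramN t m : dual_param t (- m) = - dual_param t m.
Proof. by rewrite /dual_param sqrrN mulNr. Qed.

(** [cost] in closed form when |m| < 1, and a lower bound for it at m = 1, -1.
    *)
Definition min_cost J t m : R := I_S J m + dual_value t (dual_param t m) m.

Lemma min_costN J t m : min_cost J t (- m) = min_cost J t m.
Proof.
rewrite /min_cost dual_paramN /I_S /dual_value !opprK !mulrN !opprK !sqrrN; ring.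
Qed.

Lemma min_cost0 J t : min_cost J t 0 = 0.
Proof.
rewrite /min_cost dual_param0 /I_S /dual_value expr0n/= !mulr0 !subr0 !addr0 ln1 !mulr0.
by rewrite !mul0r !addr0 subrr oppr0 mul0r addr0.
Qed.

Lemma cost_eq_min_cost J t m : 0 < t -> `|m| < 1 -> cost J t 0 m = (min_cost J t m)%:E.
Proof.
move=> t0 m1; have [z1 e] := dual_paramK m t0.
apply/eqP; rewrite eq_le; apply/andP; split.
- exact: cost_le_dual_value.
- by apply: cost_ge_dual_value => //; exact: ltW.
Qed.

Lemma cost_ge_min_cost J t m : 0 < t -> `|m| <= 1 -> ((min_cost J t m)%:E <= cost J t 0 m)%E.
Proof. by move=> t0 m1; have [z1 e] := dual_paramK m t0; exact: cost_ge_dual_value. Qed.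

(** The lower bound for the cost, at a parameter that need not be optimal. *)
Lemma dual_le_min_cost J t z m : 0 < t -> `|m| < 1 -> `|z| < 1 ->
  I_S J m + dual_value t z m <= min_cost J t m.
Proof.
move=> t0 m1 z1; rewrite -lee_fin; apply: (@le_trans _ _ (cost J t 0 m)).
  by apply: cost_ge_dual_value => //; exact: ltW.
by rewrite cost_eq_min_cost.
Qed.

Lemma min_cost_decrJ J1 J2 t m : J1 < J2 -> m != 0 -> min_cost J2 t m < min_cost J1 t m.
Proof.
move=> J12 m0; rewrite /min_cost /I_S.
have : 0 < (J2 - J1) * m ^+ 2 by rewrite mulr_gt0 ?subr_gt0// exprn_even_gt0.
lra.
Qed.

(** At a fixed parameter z > 0 the dual function decreases in t: with x = exp (-
    2 t) z, both ln (1 - x) and ln (1 - x) + ln (1 + x) increase as x decreases.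
    Take the z that is optimal for the later time. *)
Lemma min_cost_decrt J t1 t2 m : 0 < t1 -> t1 < t2 -> 0 < m < 1 ->
  min_cost J t2 m < min_cost J t1 m.
Proof.
move=> t10 t12 /andP[m0 m1]; have t20 : 0 < t2 by lra.
have am : `|m| < 1 by rewrite gtr0_norm.
have [z1 ze] := dual_paramK m t20.
have z0 : 0 < dual_param t2 m by rewrite -(dual_param0 t2) dual_param_lt.
apply: lt_le_trans (dual_le_min_cost J t10 am z1).
rewrite /min_cost ltrD2l; move: (dual_param t2 m) z1 z0 => z + z0; rewrite gtr0_norm// => z1.
rewrite /dual_value ltr_pM2r ?invr_gt0// ltrN2 ltrD2r.
have e12 : relax t2 < relax t1 by rewrite /relax ltr_expR; lra.
have e2 := relax_gt0 t2; have e1 := relax_le1 (ltW t10).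
move: (relax t1) (relax t2) e12 e2 e1 => e f ef f0 e1.
have fz : f * z < e * z by rewrite ltr_pM2r.
have ez : e * z < 1 by nra.
have fz0 : 0 < f * z by exact: mulr_gt0.
move: (e * z) (f * z) fz ez fz0 => x y yx x1 y0.
have lt1 : ln (1 - x) < ln (1 - y) by rewrite ltr_ln ?posrE; lra.
have lt2 : ln (1 - x) + ln (1 + x) < ln (1 - y) + ln (1 + y).
  by rewrite -!lnM ?posrE ?ltr_ln ?posrE; try lra; nra.
nra.
Qed.

Lemma is_derive_start_of t z : `|z| < 1 ->
  is_derive z 1 (start_of t) (sinh (2 * t) * (2 * (1 + z ^+ 2) / (1 - z ^+ 2) ^+ 2)).
Proof.
move=> z1; have d := sub_sqr_gt0 z1; rewrite /start_of; derive_auto.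
  by rewrite gt_eqF.
by field; rewrite gt_eqF.
Qed.

Lemma start_of_deriv_gt0 t z : 0 < t -> `|z| < 1 ->
  0 < sinh (2 * t) * (2 * (1 + z ^+ 2) / (1 - z ^+ 2) ^+ 2).
Proof.
move=> t0 z1; apply: mulr_gt0; first exact: sinh2t_gt0.
apply: divr_gt0; last by rewrite exprn_gt0// sub_sqr_gt0.
by apply: mulr_gt0 => //; have := sqr_ge0 z; lra.
Qed.

(** The derivative in m of I_S at m minus the initial momentum of the path with
    parameter z. *)
Definition slope J t m z : R :=
  - (J * m) + (ln (1 + m) - ln (1 - m)) / 2
  - (ln (1 - relax t * z) - ln (1 + relax t * z)) / 2.

Lemma sinh2t_relax t : sinh (2 * t) = ((relax t)^-1 - relax t) / 2.
Proof. by rewrite sinhE (_ : 2 * t / 2 = t)//; field. Qed.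

Lemma cosh2t_relax t : cosh (2 * t) = ((relax t)^-1 + relax t) / 2.
Proof. by rewrite coshE (_ : 2 * t / 2 = t)//; field. Qed.

Lemma relax_pos t z : 0 < t -> `|z| < 1 -> 0 < 1 - relax t * z /\ 0 < 1 + relax t * z.
Proof.
move=> t0 z1; have d0 : 0 < 1 - `|z| by rewrite subr_gt0.
have [||b1 b2 _ _] := @relax_bound R t z (1 - `|z|); first exact: ltW.
  by rewrite opprB addrC subrK.
by split; [exact: lt_le_trans b1|exact: lt_le_trans b2].
Qed.

(** The optimality of z, by which only the explicit dependence on m contributes
    to the derivative of the cost. *)
Lemma dual_value_stationary t z (m := start_of t z) : 0 < t -> `|z| < 1 ->
  (1 + m) * (relax t / (1 - relax t * z)) - (1 - m) * (relax t / (1 + relax t * z))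
   - 2 * z / (1 - z ^+ 2) = 0.
Proof.
move=> t0 z1; rewrite /m /start_of sinh2t_relax.
have [p1 p2] := relax_pos t0 z1; have d := sub_sqr_gt0 z1.
move: (relax t) (relax_gt0 t) p1 p2 => e e0 p1 p2.
by field; rewrite !gt_eqF.
Qed.

Lemma is_derive_param_cost J t z : 0 < t -> `|z| < 1 -> `|start_of t z| < 1 ->
  is_derive z 1 (fun z => I_S J (start_of t z) + dual_value t z (start_of t z))
   (sinh (2 * t) * (2 * (1 + z ^+ 2) / (1 - z ^+ 2) ^+ 2) * slope J t (start_of t z) z).
Proof.
move=> t0 z1 m1; have [p1 p2] := relax_pos t0 z1; have d := sub_sqr_gt0 z1.
have dm := @is_derive_start_of t z z1.
have st := dual_value_stationary t0 z1.
have [q1 q2] : 0 < 1 + start_of t z /\ 0 < 1 - start_of t z.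
  by move: m1; rewrite ltr_norml => /andP[]; lra.
move: dm; move: (sinh (2 * t) * _) => dm' dm.
rewrite /I_S /dual_value /slope.
derive_by ltac:(notypeclasses refine dm) => //.
rewrite [RHS](_ : _ = dm' * (- (J * start_of t z) + (ln (1 + start_of t z) - ln (1 - start_of t z)) / 2
   - (ln (1 - relax t * z) - ln (1 + relax t * z)) / 2) +
   ((1 + start_of t z) * (relax t / (1 - relax t * z)) -
    (1 - start_of t z) * (relax t / (1 + relax t * z)) - 2 * z / (1 - z ^+ 2)) / 2); last first.
  by rewrite st mul0r addr0.
move: (start_of t z) q1 q2 (relax t) p1 p2 => m q1 q2 e p1 p2.
move: (ln (1 + m)) (ln (1 - m)) (ln _) (ln _) => l1 l2 l3 l4.
by field; rewrite !gt_eqF.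
Qed.

Let balance m Q : R := (1 - m) * Q - (1 + m) / Q.

Let balance_lt m P E : 0 < m < 1 -> 0 < P -> P < E -> balance m P < balance m E.
Proof.
move=> /andP[m0 m1] P0 PE; rewrite /balance; apply: ltrB.
  by rewrite ltr_pM2l ?subr_gt0.
rewrite ltr_pM2l; last by lra.
by rewrite ltf_pV2 ?posrE//; lra.
Qed.

Let gibbs J m : R := (1 + m) / (1 - m) * expR (- (2 * J * m)).

Let balance_gibbs J m : 0 < m < 1 -> balance m (gibbs J m) = - (2 * m * coth_time J m).
Proof.
move=> /andP[m0 m1]; rewrite /balance /gibbs /coth_time /a_J /sinh /cosh expRN.
have := expR_gt0 (2 * J * m); move: (expR _) => e e0.
have h1 : 0 < 1 - m by lra.
have h2 : 0 < 1 + m by lra.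
by field; rewrite !gt_eqF.
Qed.

Let balance_momentum t z : 0 < t -> `|z| < 1 ->
  balance (start_of t z) ((1 - relax t * z) / (1 + relax t * z)) = - (2 * start_of t z * coth2 t).
Proof.
move=> t0 z1; rewrite /balance /start_of /coth2.
have s0 := sinh2t_gt0 t0.
have [p1 p2] := relax_pos t0 z1; have d := sub_sqr_gt0 z1.
have -> : 2 * (sinh (2 * t) * (2 * z / (1 - z ^+ 2))) * (cosh (2 * t) / sinh (2 * t)) =
   2 * (2 * z / (1 - z ^+ 2)) * cosh (2 * t).
  by field; rewrite !gt_eqF.
rewrite sinh2t_relax cosh2t_relax.
move: (relax t) (relax_gt0 t) p1 p2 => e e0 p1 p2.
by field; rewrite !gt_eqF.
Qed.

Let slopeE J t m z : 0 < t -> 0 < m < 1 -> `|z| < 1 ->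
  slope J t m z = (ln (gibbs J m) - ln ((1 - relax t * z) / (1 + relax t * z))) / 2.
Proof.
move=> t0 /andP[m0 m1] z1; have [p1 p2] := relax_pos t0 z1.
rewrite /slope /gibbs lnM ?posrE ?expR_gt0 ?divr_gt0//; try lra.
by rewrite !ln_div ?posrE ?expRK//; lra.
Qed.

Let gibbs_gt0 J m : 0 < m < 1 -> 0 < gibbs J m.
Proof. by move=> /andP[m0 m1]; rewrite /gibbs mulr_gt0 ?expR_gt0 ?divr_gt0//; lra. Qed.

(** The two momenta in the slope have the exponentials P and E of their doubles;
    compare them through the increasing map Q |-> (1 - m) Q - (1 + m) / Q, which
    sends P to - 2 a^J(m) and E to - 2 m coth 2t. *)
Lemma slope_sign J t z : 0 < t -> `|z| < 1 -> 0 < start_of t z < 1 ->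
  (0 < slope J t (start_of t z) z) = (coth_time J (start_of t z) < coth2 t) /\
  (slope J t (start_of t z) z < 0) = (coth2 t < coth_time J (start_of t z)).
Proof.
move=> t0 z1 m01; have [p1 p2] := relax_pos t0 z1.
rewrite slopeE//; set m := start_of t z in m01 *.
have m0 : 0 < m by case/andP: m01.
set P := gibbs J m; set E := (1 - relax t * z) / _.
have P0 : 0 < P by exact: gibbs_gt0.
have E0 : 0 < E by exact: divr_gt0.
have bP : balance m P = - (2 * m * coth_time J m) by exact: balance_gibbs.
have bE : balance m E = - (2 * m * coth2 t) by exact: balance_momentum.
have m20 : 0 < 2 * m by lra.
rewrite pmulr_lgt0 ?pmulr_llt0 ?invr_gt0// subr_gt0 subr_lt0 !ltr_ln ?posrE//.
case: (ltgtP P E) => h.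
- have := balance_lt m01 P0 h; rewrite bP bE ltrN2 ltr_pM2l// => h2.
  by rewrite h2 ltNge ltW.
- have := balance_lt m01 E0 h; rewrite bP bE ltrN2 ltr_pM2l// => h2.
  by rewrite h2 ltNge ltW.
- have : balance m P = balance m E by rewrite h.
  by rewrite bP bE => /oppr_inj/(mulfI (lt0r_neq0 m20)) ->; rewrite ltxx.
Qed.

(** At a critical point exp of twice the initial momentum is the Gibbs ratio P.
    With x = exp (- 2 t) z this gives x = (T - m) / (1 - m T), where T = tanh (J
    m), and (1 - z^2) (1 + m x) = 1 - x^2, from which t and z are eliminated. *)
Lemma min_cost_critical J t m : 0 < t -> 0 < J -> 0 < m < 1 -> coth_time J m = coth2 t ->
  min_cost J t m = C_M J m.
Proof.
move=> t0 J0 m01 kE; have [z1 ze] := dual_paramK m t0; have /andP[m0 m1] := m01.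
rewrite /min_cost; set z := dual_param t m in z1 ze *.
have [p1 p2] := relax_pos t0 z1; have d := sub_sqr_gt0 z1.
have PE : gibbs J m = (1 - relax t * z) / (1 + relax t * z).
  have P0 := gibbs_gt0 J m01; have E0 := divr_gt0 p1 p2.
  have bP := balance_gibbs J m01; have bE := balance_momentum t0 z1.
  rewrite ze in bE.
  case: (ltgtP (gibbs J m) ((1 - relax t * z) / (1 + relax t * z))) => // h.
  - by have := balance_lt m01 P0 h; rewrite bP bE kE ltxx.
  - by have := balance_lt m01 E0 h; rewrite bP bE kE ltxx.
have s0 : slope J t m z = 0 by rewrite slopeE// PE subrr mul0r.
have mtan := @one_sub_mtanh_gt0 _ m (J * m) ltac:(lra) (ltW (mulr_gt0 J0 m0)).
have m12 : 0 < 1 - m ^+ 2 by nra.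
have key : (1 - m * tanh (J * m)) * ((1 - relax t * z) * (1 + relax t * z)) =
   (1 - m ^+ 2) * (1 - z ^+ 2).
  move: PE ze; rewrite /gibbs /tanh /sinh /cosh /start_of sinh2t_relax.
  have -> : expR (- (2 * J * m)) = expR (- (J * m)) ^+ 2.
    by rewrite expr2 -expRD; congr expR; ring.
  rewrite expRN.
  have := expR_gt0 (J * m); move: (expR (J * m)) => X X0.
  move: (relax t) (relax_gt0 t) p1 p2 => e e0 p1 p2 PE ze.
  have h1 : 0 < 1 - m by lra.
  have n1 : 1 - m != 0 by rewrite gt_eqF.
  have nX : X != 0 by rewrite gt_eqF.
  have ne : e != 0 by rewrite gt_eqF.
  have np2 : 1 + e * z != 0 by rewrite gt_eqF.
  have nd : 1 - z ^+ 2 != 0 by rewrite gt_eqF.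
  have PE' : (1 + m) * (1 + e * z) = (1 - m) * (1 - e * z) * X ^+ 2.
    have -> : (1 - m) * (1 - e * z) * X ^+ 2 =
      (1 - m) * X ^+ 2 * (1 + e * z) * ((1 - e * z) / (1 + e * z)) by field.
    by rewrite -PE; field; rewrite nX n1.
  have ze' : (1 - e ^+ 2) * z = e * m * (1 - z ^+ 2).
    by rewrite -{1}ze; field; rewrite nd ne.
  have X2 : 0 < X ^+ 2 + 1 by have := sqr_ge0 X; lra.
  have -> : (1 - m * ((X - X^-1) / 2 / ((X + X^-1) / 2))) =
      (X ^+ 2 + 1 - m * (X ^+ 2 - 1)) / (X ^+ 2 + 1).
    by field; rewrite nX/= gt_eqF.
  have h2 : (1 - z ^+ 2) * (1 + e * z * m) = 1 - (e * z) ^+ 2.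
    have h3 : (1 - e ^+ 2) * z * z = e * m * (1 - z ^+ 2) * z by rewrite ze'.
    by move: h3; lra.
  have h4 : (X ^+ 2 + 1 - m * (X ^+ 2 - 1)) * (1 + e * z * m) = (1 - m ^+ 2) * (X ^+ 2 + 1).
    have h5 : m * ((1 + m) * (1 + e * z)) = m * ((1 - m) * (1 - e * z) * X ^+ 2) by rewrite PE'.
    by move: h5; lra.
  have -> : (1 - e * z) * (1 + e * z) = (1 - z ^+ 2) * (1 + e * z * m) by rewrite h2; ring.
  have nX2 : X ^+ 2 + 1 != 0 by rewrite gt_eqF.
  transitivity ((X ^+ 2 + 1 - m * (X ^+ 2 - 1)) * (1 + e * z * m) *
    ((1 - z ^+ 2) / (X ^+ 2 + 1))); first by field.
  by rewrite h4; field.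
have L : ln (1 - m * tanh (J * m)) + ln (1 - relax t * z) + ln (1 + relax t * z) =
    ln (1 + m) + ln (1 - m) + ln (1 - z ^+ 2).
  have a1 : 0 < 1 + m by lra.
  have a2 : 0 < 1 - m by lra.
  have pE x y : 0 < x -> 0 < y -> ln x + ln y = ln (x * y) :> R.
    by move=> x0 y0; rewrite lnM.
  rewrite -addrA !pE//; try exact: mulr_gt0.
  by rewrite key; congr (ln (_ * _)); ring.
move: s0 L; rewrite /slope /I_S /dual_value /C_M.
move: (ln (1 + m)) (ln (1 - m)) (ln (1 - relax t * z)) (ln (1 + relax t * z))
  (ln (1 - z ^+ 2)) (ln (1 - m * tanh _)) => l1 l2 l3 l4 l5 l6 s0 L.
have s1 : m * (- (J * m) + (l1 - l2) / 2 - (l3 - l4) / 2) = 0 by rewrite s0 mulr0.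
by move: s1; lra.
Qed.

End static.

(** * Minimizers of the cost *)

Section minimizers.
Context {R : realType}.
Implicit Types (J t z m x u : R).

Lemma start_of_between t m1 m2 z : 0 < t -> dual_param t m1 < z < dual_param t m2 ->
  `|z| < 1 /\ m1 < start_of t z < m2.
Proof.
move=> t0 /andP[z1 z2]; have [a1 e1] := dual_paramK m1 t0; have [a2 e2] := dual_paramK m2 t0.
have az : `|z| < 1.
  by move: a1 a2; rewrite !ltr_norml => /andP[h1 _] /andP[_ h2]; lra.
split=> //; apply/andP; split.
  by have := start_of_lt t0 a1 az z1; rewrite e1.
by have := start_of_lt t0 az a2 z2; rewrite e2.
Qed.

(** The cost in the parameter z, in which no square roots occur. *)
Definition param_cost J t z : R := I_S J (start_of t z) + dual_value t z (start_of t z).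

Definition param_cost' J t u : R :=
  sinh (2 * t) * (2 * (1 + u ^+ 2) / (1 - u ^+ 2) ^+ 2) * slope J t (start_of t u) u.

Lemma param_cost_derive J t m1 m2 u : 0 < t -> 0 <= m1 -> m2 < 1 ->
  dual_param t m1 <= u <= dual_param t m2 ->
  is_derive u 1 (param_cost J t) (param_cost' J t u).
Proof.
move=> t0 m10 m21 /andP[u1 u2].
have [a1 e1] := dual_paramK m1 t0; have [a2 e2] := dual_paramK m2 t0.
have au : `|u| < 1.
  by move: a1 a2; rewrite !ltr_norml => /andP[h1 _] /andP[_ h2]; lra.
have h1 : m1 <= start_of t u.
  by move: u1; rewrite le_eqVlt => /orP[/eqP<-|/(start_of_lt t0 a1 au)/ltW]; rewrite e1.
have h2 : start_of t u <= m2.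
  by move: u2; rewrite le_eqVlt => /orP[/eqP->|/(start_of_lt t0 au a2)/ltW]; rewrite e2.
by apply: is_derive_param_cost => //; rewrite ger0_norm; lra.
Qed.

Lemma param_costE J t m : 0 < t ->
  min_cost J t m = param_cost J t (dual_param t m).
Proof. by move=> t0; have [_ e] := dual_paramK m t0; rewrite /min_cost /param_cost e. Qed.

Lemma min_cost_incr J t m1 m2 : 0 < t -> 0 <= m1 -> m1 < m2 -> m2 < 1 ->
  (forall u, m1 < u < m2 -> coth_time J u < coth2 t) -> min_cost J t m1 < min_cost J t m2.
Proof.
move=> t0 m10 m12 m21 hk; rewrite !param_costE//.
apply: (@derive_lt _ (param_cost J t) (param_cost' J t) _ _ (dual_param_lt t0 m12)).
  by move=> u; apply: param_cost_derive.
move=> u uz; have [au mu] := start_of_between t0 uz.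
rewrite /param_cost'; apply: mulr_gt0; first exact: start_of_deriv_gt0.
have m01 : 0 < start_of t u < 1 by lra.
by rewrite (slope_sign J t0 au m01).1 hk.
Qed.

Lemma min_cost_decr J t m1 m2 : 0 < t -> 0 <= m1 -> m1 < m2 -> m2 < 1 ->
  (forall u, m1 < u < m2 -> coth2 t < coth_time J u) -> min_cost J t m2 < min_cost J t m1.
Proof.
move=> t0 m10 m12 m21 hk; rewrite !param_costE//.
apply: (@derive_gt _ (param_cost J t) (param_cost' J t) _ _ (dual_param_lt t0 m12)).
  by move=> u; apply: param_cost_derive.
move=> u uz; have [au mu] := start_of_between t0 uz.
rewrite /param_cost' pmulr_rlt0; last exact: start_of_deriv_gt0.
have m01 : 0 < start_of t u < 1 by lra.
by rewrite (slope_sign J t0 au m01).2 hk.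
Qed.

Lemma coth2_gt1 t : 0 < t -> 1 < coth2 t.
Proof.
by move=> t0; rewrite /coth2 ltr_pdivlMr ?sinh2t_gt0// mul1r sinh_lt_cosh.
Qed.

Lemma coth_time_lt_near1 J t : 0 < t -> exists2 m, 0 < m < 1 &
  forall u, m < u < 1 -> coth_time J u < coth2 t.
Proof.
move=> t0; have k1 := coth_time1_lt0 J; have kt := coth2_gt1 t0.
have ck : {for 1, continuous (coth_time J)}.
  by apply: derive_continuous (is_derive_coth_time J _); rewrite oner_eq0.
have /nbhs_ballP[e /= e0 he] : \forall u \near (1 : R), coth_time J u < coth2 t.
  by apply: (cvgr_lt _ ck); lra.
exists (Num.max (1 - e) (1 / 2)).
  by rewrite lt_max gt_max; apply/andP; split; [apply/orP; right|]; lra.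
move=> u; rewrite gt_max => /andP[/andP[h1 h2] h3].
by apply: he; rewrite /ball/= gtr0_norm; lra.
Qed.

(** At m = 1 only a lower bound is available. The cost without the term (1 - m)
    ln (1 - m) / 2, which is nonpositive and vanishes at m = 1, is continuous
    there. *)
Lemma min_cost_lt_at1 J t : 0 < t -> exists2 m, 0 < m < 1 & min_cost J t m < min_cost J t 1.
Proof.
move=> t0; have [m0 /andP[m00 m01] hk] := @coth_time_lt_near1 J t t0.
exists m0; first by rewrite m00.
pose m1 := (m0 + 1) / 2.
have m01' : m0 < m1 by rewrite /m1; lra.
have m11 : m1 < 1 by rewrite /m1; lra.
have inc a b : m0 <= a -> a < b -> b < 1 -> min_cost J t a < min_cost J t b.
  move=> ma ab b1; apply: min_cost_incr => //; first by lra.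
  by move=> u /andP[au ub]; apply: hk; lra.
apply: lt_le_trans (inc m0 m1 (lexx _) m01' m11) _.
rewrite leNgt; apply/negP => v1.
(* H is the cost without (1 - m) ln (1 - m) / 2. *)
pose H z := - (J * start_of t z ^+ 2 / 2) + (1 + start_of t z) / 2 * ln (1 + start_of t z)
  + dual_value t z (start_of t z).
have [a1 e1] := dual_paramK 1 t0.
have HV z : param_cost J t z = H z + (1 - start_of t z) / 2 * ln (1 - start_of t z).
  by rewrite /param_cost /H /I_S; ring.
have cH : {for dual_param t 1, continuous H}.
  have : exists d, is_derive (dual_param t 1) 1 H d; last by move=> [d]; exact: derive_continuous.
  have [p1 p2] := relax_pos t0 a1; have d := sub_sqr_gt0 a1.
  { eexists; rewrite /H /dual_value.
    repeat first [notypeclasses refine (is_derive_start_of _ _) | derive_step].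
    all: cbv beta; rewrite ?e1 //. }
have H1 : H (dual_param t 1) < min_cost J t m1.
  apply: le_lt_trans v1.
  by rewrite param_costE// HV e1 subrr mul0r mul0r addr0.
have : \forall z \near dual_param t 1, H z < min_cost J t m1 by exact: (cvgr_lt _ cH).
move=> /nbhs_ballP[e /= e0 he].
have z11 : dual_param t m1 < dual_param t 1 by exact: dual_param_lt.
pose z := Num.max (dual_param t 1 - e / 2) ((dual_param t m1 + dual_param t 1) / 2).
have z1 : dual_param t m1 < z by rewrite lt_max; apply/orP; right; lra.
have z2 : z < dual_param t 1 by rewrite gt_max; apply/andP; split; lra.
have z3 : dual_param t 1 - e / 2 <= z by rewrite le_max lexx.
have [az /andP[mz1 mz2]] := start_of_between t0 (introT andP (conj z1 z2)).
have := inc m1 (start_of t z) (ltW m01') mz1 mz2.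
rewrite [ltRHS]param_costE// dual_param_start_of// HV.
have : H z < min_cost J t m1.
  by apply: he; rewrite /ball/= gtr0_norm; lra.
have : ln (1 - start_of t z) <= 0 by apply: ln_le0; lra.
have h : 0 < 1 - start_of t z by lra.
nra.
Qed.

Lemma m_hat_eq J t m : 0 < t -> 0 <= m < 1 ->
  (forall x, 0 <= x < 1 -> min_cost J t m <= min_cost J t x) ->
  (forall x, m < x < 1 -> min_cost J t m < min_cost J t x) ->
  m_hat J t = m.
Proof.
move=> t0 /andP[m0 m1] hle hlt.
have am : `|m| < 1 by rewrite ger0_norm.
have v1 : min_cost J t m < min_cost J t 1.
  have [y /andP[y0 y1]] := @min_cost_lt_at1 J t t0.
  by apply: le_lt_trans; apply: hle; rewrite (ltW y0).
have vabs x : min_cost J t `|x| = min_cost J t x.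
  by case: (ger0P x) => // _; rewrite min_costN.
have hx x : -1 <= x <= 1 -> (cost J t 0 m <= cost J t 0 x)%E.
  rewrite -ler_norml => x1; apply: le_trans (cost_ge_min_cost J t0 x1).
  rewrite (cost_eq_min_cost J t0 am) lee_fin -(vabs x).
  move: x1; rewrite le_eqVlt => /orP[/eqP->|x1]; first exact: ltW.
  by apply: hle; rewrite normr_ge0.
have mm : minimizers J t 0 m.
  by split=> //; rewrite -ler_norml ltW.
have ub x : minimizers J t 0 x -> x <= m.
  move=> [xI xmin]; rewrite leNgt; apply/negP => mx.
  have := xmin m; rewrite -ler_norml ltW// => /(_ isT).
  rewrite (cost_eq_min_cost J t0 am) => hm.
  have /andP[_ x1] := xI.
  have x0 : 0 < x by lra.
  suff lt : ((min_cost J t m)%:E < cost J t 0 x)%E.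
    by have := lt_le_trans lt hm; rewrite ltxx.
  apply: (@lt_le_trans _ _ (min_cost J t x)%:E); last first.
    by apply: cost_ge_min_cost => //; rewrite ger0_norm// ltW.
  rewrite lte_fin; move: x1; rewrite le_eqVlt => /orP[/eqP->//|x1].
  by apply: hlt; rewrite mx.
rewrite /m_hat; apply: xget_unique; first by split.
by move=> y [ymin yub]; apply/le_anti; rewrite ub//= yub.
Qed.

(** The point where a^J(m) / m falls below coth 2t for good: the only possible
    nonzero minimizer, up to sign. *)
Definition last_cross J t m := [/\ 0 < m < 1, coth_time J m = coth2 t &
  forall u, m < u < 1 -> coth_time J u < coth2 t].

Lemma min_cost_gt0_no_cross J t : 0 < t -> (forall u, 0 < u < 1 -> coth_time J u < coth2 t) ->
  forall x, 0 < x < 1 -> 0 < min_cost J t x.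
Proof.
move=> t0 hk x /andP[x0 x1]; rewrite -(min_cost0 J t).
apply: min_cost_incr => // u /andP[u0 ux]; apply: hk; lra.
Qed.

Lemma m_hat_eq0 J t : 0 < t -> (forall x, 0 < x < 1 -> 0 < min_cost J t x) -> m_hat J t = 0.
Proof.
move=> t0 hv; apply: m_hat_eq => //; rewrite ?lexx ?ltr01//.
- move=> x /andP[]; rewrite le_eqVlt => /orP[/eqP<-//|x0 x1].
  by rewrite min_cost0 ltW// hv// x0.
- by move=> x x01; rewrite min_cost0 hv.
Qed.

Lemma min_cost_gt_cross J t m x : 0 < t -> last_cross J t m -> m < x < 1 ->
  min_cost J t m < min_cost J t x.
Proof.
move=> t0 [/andP[m0 m1] km hk] /andP[mx x1]; apply: min_cost_incr => //; first exact: ltW.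
by move=> u /andP[mu ux]; apply: hk; rewrite mu (lt_trans ux).
Qed.

(** If a^J(x) / x <= coth 2t, unimodality gives the same before x, so the cost
    increases on [0, x]; otherwise a^J(u) / u stays above coth 2t up to m, so
    the cost decreases on [x, m]. *)
Lemma min_cost_lt_cross J t m x : 0 < t -> 0 < J -> last_cross J t m -> 0 < x < m ->
  0 < min_cost J t x \/ min_cost J t m < min_cost J t x.
Proof.
move=> t0 J0 [/andP[m0 m1] km hk] /andP[x0 xm].
have [kx|kx] := leP (coth_time J x) (coth2 t).
- left; rewrite -(min_cost0 J t); apply: min_cost_incr => //; first exact: lt_trans m1.
  move=> u /andP[u0 ux]; apply: (lt_le_trans _ kx).
  rewrite ltNge; apply/negP => ku.
  have := @coth_time_unimodal _ J u x m J0 u0 ux ku xm.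
  by rewrite km => /lt_le_trans/(_ kx); rewrite ltxx.
- right; apply: min_cost_decr => //; first exact: ltW.
  move=> u /andP[xu um]; rewrite ltNge; apply/negP => ku.
  have := @coth_time_unimodal _ J x u m J0 x0 xu (le_trans ku (ltW kx)) um.
  by rewrite km => /lt_le_trans/(_ ku); rewrite ltxx.
Qed.

Lemma m_hat_cross J t m : 0 < t -> 0 < J -> last_cross J t m -> C_M J m <= 0 ->
  m_hat J t = m.
Proof.
move=> t0 J0 lc; have [m01 km hk] := lc; have /andP[m0 m1] := m01.
rewrite -(min_cost_critical t0 J0 m01 km) => vm.
apply: m_hat_eq => //; first by rewrite ltW.
- move=> x /andP[]; rewrite le_eqVlt => /orP[/eqP<-|x0 x1]; first by rewrite min_cost0.
  case: (ltgtP x m) => [xm|mx|->//].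
    have [|/ltW//] := min_cost_lt_cross t0 J0 lc (introT andP (conj x0 xm)).
    by move=> /ltW; exact: le_trans.
  by apply/ltW/min_cost_gt_cross => //; rewrite mx.
- by move=> x; exact: min_cost_gt_cross.
Qed.

Lemma min_cost_ge0_cross J t m : 0 < t -> 0 < J -> last_cross J t m -> 0 <= C_M J m ->
  forall x, 0 <= x < 1 -> 0 <= min_cost J t x.
Proof.
move=> t0 J0 lc; have [m01 km hk] := lc; have /andP[m0 m1] := m01.
rewrite -(min_cost_critical t0 J0 m01 km) => vm x /andP[].
rewrite le_eqVlt => /orP[/eqP<-|x0 x1]; first by rewrite min_cost0.
case: (ltgtP x m) => [xm|mx|->//].
  have [/ltW//|/ltW] := min_cost_lt_cross t0 J0 lc (introT andP (conj x0 xm)).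
  exact: le_trans.
by apply: le_trans vm _; apply/ltW/min_cost_gt_cross => //; rewrite mx.
Qed.

End minimizers.

(** * Hausdorff distance of cones *)

Section hausdorff.
Context {R : realType}.
Implicit Types (A B : set (R * R)) (p q : R * R) (e m t s : R).

Lemma euclidean_dist_ge0 p q : 0 <= euclidean_dist p q.
Proof. exact: sqrtr_ge0. Qed.

Lemma euclidean_dist_le p q : euclidean_dist p q <= `|p.1 - q.1| + `|p.2 - q.2|.
Proof.
have a0 := normr_ge0 (p.1 - q.1); have b0 := normr_ge0 (p.2 - q.2).
rewrite /euclidean_dist -(real_normK (num_real (p.1 - q.1))) -(real_normK (num_real (p.2 - q.2))).
have -> : `|p.1 - q.1| + `|p.2 - q.2| = Num.sqrt ((`|p.1 - q.1| + `|p.2 - q.2|) ^+ 2).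
  by rewrite sqrtr_sqr (ger0_norm (addr_ge0 a0 b0)).
apply: ler_wsqrtr.
rewrite sqrrD; have := mulr_ge0 a0 b0; lra.
Qed.

Lemma dist_to_bounds A p e : A !=set0 -> (exists2 q, A q & euclidean_dist p q <= e) ->
  0 <= dist_to A p <= e.
Proof.
move=> A0 [q Aq pq]; rewrite /dist_to.
have lb : lbound (euclidean_dist p @` A) 0.
  by move=> _ [r _ <-]; exact: euclidean_dist_ge0.
apply/andP; split.
  by apply: lb_le_inf => //; exists (euclidean_dist p q); exists q.
by apply: le_trans pq; apply: ge_inf; [exists 0|exists q].
Qed.

Lemma sup_dist_bounds A B e : A !=set0 -> B !=set0 ->
  (forall p, A p -> exists2 q, B q & euclidean_dist p q <= e) ->
  0 <= sup (dist_to B @` A) <= e.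
Proof.
move=> [a Aa] B0 H.
have ub : ubound (dist_to B @` A) e.
  by move=> _ [p Ap <-]; have /andP[] := dist_to_bounds B0 (H p Ap).
apply/andP; split.
  have /andP[h _] := dist_to_bounds B0 (H a Aa).
  apply: le_trans h _; apply: ub_le_sup; [by exists e|by exists a].
by apply: ge_sup => //; exists (dist_to B a); exists a.
Qed.

Lemma hausdorff_dist_bounds A B e : A !=set0 -> B !=set0 ->
  (forall p, A p -> exists2 q, B q & euclidean_dist p q <= e) ->
  (forall q, B q -> exists2 p, A p & euclidean_dist q p <= e) ->
  0 <= hausdorff_dist A B <= e.
Proof.
move=> A0 B0 HA HB; rewrite /hausdorff_dist.
have /andP[h1 h2] := sup_dist_bounds A0 B0 HA.
have /andP[h3 h4] := sup_dist_bounds B0 A0 HB.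
by rewrite le_max h1/= ge_max h2.
Qed.

(** The cone of half-width m at time 0; unlike [cone], it does not refer to the
    minimization problem. *)
Definition cone_of (m t : R) : set (R * R) :=
  [set p | 0 <= p.1 <= t /\ `|p.2| <= m * (sinh (2 * (t - p.1)) / sinh (2 * t))].

Lemma cone_of_neq0 m t : 0 <= t -> 0 <= m -> cone_of m t !=set0.
Proof.
move=> t0 m0; exists (0, 0); split=> /=; first by rewrite lexx.
rewrite normr0 subr0; have [->|h] := eqVneq (sinh (2 * t)) 0.
  by rewrite invr0 !mulr0.
by rewrite divff// mulr1.
Qed.

Lemma sinh_ratio t s : 0 < t ->
  sinh (2 * (t - s)) / sinh (2 * t) = cosh (2 * s) - coth2 t * sinh (2 * s).
Proof.
move=> t0; rewrite (_ : 2 * (t - s) = 2 * t - 2 * s); last by ring.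
rewrite sinhB /coth2; have := sinh2t_gt0 t0; move: (sinh (2 * t)) => x x0.
by field; rewrite gt_eqF.
Qed.

(** The time coordinate is cut at t0, which costs at most |t - t0|, and the
    space coordinate is clamped. The profile sinh (2 (t - s)) / sinh 2t is cosh
    2s - coth 2t sinh 2s, whose dependence on t is explicit. *)
Lemma cone_of_near m (m0 : R) t (t0 : R) p : 0 < t -> 0 < t0 -> 0 <= m -> 0 <= m0 ->
  cone_of m t p -> exists2 q, cone_of m0 t0 q &
    euclidean_dist p q <= `|t - t0| + (`|m - m0| +
       m0 * (`|coth2 t - coth2 t0| * sinh (2 * t))).
Proof.
move=> t1 t01 m1 m01 [/andP[s0 st] px].
set D := `|m - m0| + _.
have r0 : 0 <= sinh (2 * (t - p.1)) / sinh (2 * t) <= 1.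
  have h := sinh2t_gt0 t1.
  rewrite ler_pdivrMr// mul1r sinh_le ?andbT; last by lra.
  by rewrite divr_ge0// ?(ltW h)// -sinh0 sinh_le//; lra.
have hD : m * (sinh (2 * (t - p.1)) / sinh (2 * t)) <=
   m0 * (sinh (2 * (t0 - p.1)) / sinh (2 * t0)) + D.
  rewrite /D.
  have -> : m * (sinh (2 * (t - p.1)) / sinh (2 * t)) =
    (m - m0) * (sinh (2 * (t - p.1)) / sinh (2 * t)) +
     m0 * (sinh (2 * (t - p.1)) / sinh (2 * t)) by ring.
  rewrite addrCA lerD//.
    apply: le_trans (ler_norm _) _; rewrite normrM (ger0_norm (proj1 (andP r0))).
    by rewrite ler_piMr//; case/andP: r0.
  rewrite !sinh_ratio// -mulrDr ler_wpM2l//.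
  have a1 : (coth2 t0 - coth2 t) * sinh (2 * p.1) <= `|coth2 t - coth2 t0| * sinh (2 * t).
    have sp : 0 <= sinh (2 * p.1) by rewrite -sinh0; apply: sinh_le; lra.
    apply: (@le_trans _ _ (`|coth2 t - coth2 t0| * sinh (2 * p.1))).
      by apply: ler_wpM2r => //; rewrite distrC ler_norm.
    by apply: ler_wpM2l => //; apply: sinh_le; lra.
  lra.
have D0 : 0 <= D.
  by rewrite /D addr_ge0// mulr_ge0// mulr_ge0// ltW// sinh2t_gt0.
have [pt|tp] := leP p.1 t0.
- pose b := m0 * (sinh (2 * (t0 - p.1)) / sinh (2 * t0)).
  have b0 : 0 <= b.
    by rewrite /b mulr_ge0// divr_ge0// -sinh0 sinh_le//; lra.
  exists (p.1, Num.max (- b) (Num.min p.2 b)).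
    split=> /=; first by rewrite s0.
    by rewrite -/b ler_norml; case_min_max; lra.
  apply: le_trans (euclidean_dist_le _ _) _ => /=; rewrite subrr normr0 add0r.
  apply: (@le_trans _ _ D); last by rewrite lerDr.
  move: (le_trans px hD); rewrite -/b !ler_norml => /andP[h1 h2].
  by case_min_max; lra.
- exists (t0, 0).
    split=> /=; first by rewrite lexx ltW.
    by rewrite normr0 subrr mulr0 sinh0 mul0r mulr0.
  apply: le_trans (euclidean_dist_le _ _) _ => /=; rewrite subr0.
  apply: lerD.
    by rewrite !ger0_norm; lra.
  apply: le_trans px _; apply: le_trans hD _.
  rewrite gerDr mulr_ge0_le0// mulr_le0_ge0//.
    by rewrite -sinh0 sinh_le//; lra.
  by rewrite invr_ge0 ltW// sinh2t_gt0.
Qed.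

Lemma hausdorff_cone_cvg (T : Type) (F : set_system T) (FF : ProperFilter F)
    (m t : T -> R) (m0 t0 : R) : 0 < t0 -> 0 <= m0 ->
  (\forall x \near F, 0 <= m x) ->
  t x @[x --> F] --> t0 -> m x @[x --> F] --> m0 ->
  hausdorff_dist (cone_of (m x) (t x)) (cone_of m0 t0) @[x --> F] --> (0 : R).
Proof.
move=> t00 m00 mge tcv mcv.
have csinh : {for t0, continuous (fun u : R => sinh (2 * u))}.
  exact: derive_continuous (is_derive_sinh_lin 2 t0).
have kcv : coth2 (t x) @[x --> F] --> coth2 t0.
  by apply: (cvg_comp _ _ tcv); exact: coth2_continuous.
have scv : sinh (2 * t x) @[x --> F] --> sinh (2 * t0).
  by apply: (cvg_comp _ _ tcv csinh).
pose bnd x := `|t x - t0| + (`|m x - m0| +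
   (m0 + m x) * (`|coth2 (t x) - coth2 t0| * (sinh (2 * t x) + sinh (2 * t0)))).
have bcv : bnd x @[x --> F] --> (0 : R).
  have -> : 0 = `|t0 - t0| + (`|m0 - m0| +
     (m0 + m0) * (`|coth2 t0 - coth2 t0| * (sinh (2 * t0) + sinh (2 * t0)))) :> R.
    by rewrite !subrr normr0 mul0r mulr0 !addr0.
  apply: cvgD; first by apply: cvg_norm; apply: cvgB => //; exact: cvg_cst.
  apply: cvgD; first by apply: cvg_norm; apply: cvgB => //; exact: cvg_cst.
  apply: cvgM; first by apply: cvgD => //; exact: cvg_cst.
  apply: cvgM; first by apply: cvg_norm; apply: cvgB => //; exact: cvg_cst.
  by apply: cvgD => //; exact: cvg_cst.
apply: (@squeeze_cvgr _ _ _ _ (cst 0) bnd) => //; last exact: cvg_cst.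
near=> x.
have tx0 : 0 < t x by near: x; exact: (cvgr_gt _ tcv).
have mx0 : 0 <= m x by near: x.
have s1 := sinh2t_gt0 tx0; have s2 := sinh2t_gt0 t00.
have dk := normr_ge0 (coth2 (t x) - coth2 t0).
have q1 := mulr_ge0 dk (ltW s1); have q2 := mulr_ge0 dk (ltW s2).
have bE : bnd x = `|t x - t0| + (`|m x - m0| +
    (m0 * (`|coth2 (t x) - coth2 t0| * sinh (2 * t x)) +
     m0 * (`|coth2 (t x) - coth2 t0| * sinh (2 * t0)) +
     m x * (`|coth2 (t x) - coth2 t0| * sinh (2 * t x)) +
     m x * (`|coth2 (t x) - coth2 t0| * sinh (2 * t0)))) by rewrite /bnd; ring.
have w1 := mulr_ge0 m00 q1; have w2 := mulr_ge0 m00 q2.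
have w3 := mulr_ge0 mx0 q1; have w4 := mulr_ge0 mx0 q2.
have b1 : `|t x - t0| + (`|m x - m0| +
       m0 * (`|coth2 (t x) - coth2 t0| * sinh (2 * t x))) <= bnd x.
  by rewrite bE !lerD2l -!addrA lerDl !addr_ge0.
have b2 : `|t0 - t x| + (`|m0 - m x| +
       m x * (`|coth2 t0 - coth2 (t x)| * sinh (2 * t0))) <= bnd x.
  rewrite bE distrC (distrC m0) (distrC (coth2 t0)) !lerD2l lerDr !addr_ge0//.
apply: hausdorff_dist_bounds.
- by apply: cone_of_neq0 => //; exact: ltW.
- by apply: cone_of_neq0 => //; exact: ltW.
- move=> p hp; have [q hq pq] := cone_of_near tx0 t00 mx0 m00 hp.
  by exists q => //; exact: le_trans pq b1.
- move=> p hp; have [q hq pq] := cone_of_near t00 tx0 m00 mx0 hp.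
  by exists q => //; exact: le_trans pq b2.
Unshelve. all: by end_near. Qed.

Lemma cone_of0_compact t : compact (cone_of 0 t).
Proof.
have -> : cone_of 0 t = (fun s : R => (s, 0 : R)) @` `[0, t]%classic.
  apply/seteqP; split=> [[s x]|_ [s st <-]] /=.
    move=> [/= st]; rewrite mul0r normr_le0 => /eqP->.
    by exists s => //; rewrite in_itv.
  by move: st; rewrite /= in_itv/= => st; split=> //; rewrite normr0 mul0r.
apply: continuous_compact; last exact: segment_compact.
apply: continuous_subspaceT => s.
by apply: (@cvg_pair _ _ _ _ (nbhs (s : R)) (nbhs (0 : R))); [exact: cvg_id|exact: cvg_cst].
Qed.

End hausdorff.

(** * Phases and the critical time *)

Section phases.
Context {R : realType}.
Implicit Types (J t m x c : R).

Lemma coth2E t : 0 < t -> coth2 t = 1 + 2 / (expR (4 * t) - 1).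
Proof.
move=> t0; rewrite /coth2 sinh2t_relax cosh2t_relax /relax expRN.
have -> : expR (4 * t) = expR (2 * t) ^+ 2 by rewrite expr2 -expRD; congr expR; ring.
have : 1 < expR (2 * t) by rewrite -[ltLHS]expR0 ltr_expR; lra.
move: (expR _) => e e1.
have h : 0 < e ^+ 2 - 1 by nra.
by field; rewrite !gt_eqF//; lra.
Qed.

Lemma expR4_sub1_gt0 t : 0 < t -> 0 < expR (4 * t) - 1.
Proof. by move=> t0; rewrite subr_gt0 -[ltLHS]expR0 ltr_expR; lra. Qed.

Lemma coth2_decr t1 t2 : 0 < t1 -> t1 < t2 -> coth2 t2 < coth2 t1.
Proof.
move=> t0 t12; rewrite !coth2E//; last by lra.
rewrite ltrD2l ltr_pM2l// ltf_pV2 ?posrE ?expR4_sub1_gt0//; last by lra.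
by rewrite ltrD2r ltr_expR; lra.
Qed.

Lemma coth2_arccoth c : 1 < c -> 0 < arccoth c / 2 /\ coth2 (arccoth c / 2) = c.
Proof.
move=> c1; have q1 : 1 < (c + 1) / (c - 1) by rewrite ltr_pdivlMr; lra.
have t0 : 0 < arccoth c / 2 by rewrite /arccoth !divr_gt0// ln_gt0.
split => //; rewrite coth2E//.
have -> : 4 * (arccoth c / 2) = ln ((c + 1) / (c - 1)) by rewrite /arccoth; field.
rewrite lnK ?posrE; last by lra.
have h : c - 1 != 0 by rewrite gt_eqF//; lra.
by field; rewrite h/=; apply/eqP; lra.
Qed.

Lemma coth_time_continuous J a b : 0 < a -> {within `[a, b], continuous (coth_time J)}.
Proof.
move=> a0; apply: continuous_in_subspaceT => s; rewrite inE/= in_itv/= => /andP[sa sb].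
by apply: derive_continuous (is_derive_coth_time J _); rewrite gt_eqF//; lra.
Qed.

(** Intermediate values on [x, 1]; beyond x the function decreases. *)
Lemma cross_exists J t x : 0 < J -> 0 < t -> 0 < x < 1 -> coth2 t < coth_time J x ->
  coth_time_num J x <= 0 -> exists2 m, x < m & last_cross J t m.
Proof.
move=> J0 t0 /andP[x0 x1] kx nx.
have k1 : coth_time J 1 < coth2 t by have := coth_time1_lt0 J; have := coth2_gt1 t0; lra.
have [|m + km] := @IVT _ (coth_time J) x 1 (coth2 t) (ltW x1) (@coth_time_continuous J x 1 x0).
  by rewrite ge_min le_max (ltW k1) (ltW kx) orbT.
rewrite in_itv/= => /andP[xm m1].
have {}xm : x < m by rewrite lt_neqAle xm andbT; apply/eqP => e; move: kx; rewrite e km ltxx.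
have {}m1 : m < 1 by rewrite lt_neqAle m1 andbT; apply/eqP => e; move: k1; rewrite -e km ltxx.
exists m => //; split => //; first by rewrite m1 (lt_trans x0).
by move=> u /andP[mu _]; rewrite -km; apply: (@coth_time_decr_after _ _ x) => //; exact: ltW.
Qed.

Lemma small_no_cross J t : 0 < J -> J <= 3 / 2 -> 0 < t -> 2 * J - 1 <= coth2 t ->
  (forall x, 0 < x < 1 -> 0 < min_cost J t x) /\ m_hat J t = 0.
Proof.
move=> J0 J1 t0 kt.
have v x : 0 < x < 1 -> 0 < min_cost J t x.
  apply: min_cost_gt0_no_cross => // u /andP[u0 _].
  exact: lt_le_trans (coth_time_lt_limit J0 J1 u0) kt.
by split=> //; exact: m_hat_eq0.
Qed.

(** a^J(m) / m exceeds coth 2t near 0, so 0 is a local maximum of the cost. *)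
Lemma min_cost_neg_near0 J t : 0 < t -> coth2 t < 2 * J - 1 ->
  exists2 x, 0 < x < 1 & coth2 t < coth_time J x /\ min_cost J t x < 0.
Proof.
move=> t0 kt; have [e e0 he] := coth_time_gt_near0 kt.
pose x := Num.min (e / 2) (1 / 2).
have x0 : 0 < x by rewrite lt_min; apply/andP; split; lra.
have xe : x < e by rewrite gt_min; apply/orP; left; lra.
have x1 : x < 1 by rewrite gt_min; apply/orP; right; lra.
exists x; first by rewrite x0.
split; first by apply: he; rewrite x0.
rewrite -(min_cost0 J t); apply: min_cost_decr => // u /andP[u0 ux].
by apply: he; rewrite u0 (lt_trans ux).
Qed.

Lemma small_cross J t : 0 < J -> J <= 3 / 2 -> 0 < t -> coth2 t < 2 * J - 1 ->
  last_cross J t (m_hat J t).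
Proof.
move=> J0 J1 t0 kt; have [x x01 [kx vx]] := min_cost_neg_near0 t0 kt.
have x0 : 0 < x by case/andP: x01.
have [m xm lc] := cross_exists J0 t0 x01 kx (ltW (coth_time_num_lt0 J0 J1 x0)).
have [m01 km hm] := lc; have /andP[m0 m1] := m01.
rewrite (@m_hat_cross _ J t m)// -(min_cost_critical t0 J0 m01 km) -(min_cost0 J t).
apply/ltW/min_cost_decr => // u /andP[u0 um].
by rewrite -km; exact: coth_time_decr.
Qed.

Lemma Psi_c_small J : 1 < J -> J <= 3 / 2 -> 0 < Psi_c J /\ coth2 (Psi_c J) = 2 * J - 1.
Proof. by move=> J1 J32; rewrite /Psi_c J32; apply: coth2_arccoth; lra. Qed.

(** m_star lies beyond the maximum of a^J(m) / m, because C_M has come back to 0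
    there, and a^J(m_star) / m_star > 1, because C_M(m_star) = 0 forces tanh (J
    m_star) > m_star. *)
Lemma Psi_c_large J : 3 / 2 < J -> 0 < Psi_c J /\ last_cross J (Psi_c J) (m_star J).
Proof.
move=> J1; have J0 : 0 < J by lra.
have [m01 Cm] := m_starP J1; have /andP[m0 m1] := m01.
rewrite /Psi_c leNgt J1/= /time_of -/(coth_time J (m_star J)).
have k1 : 1 < coth_time J (m_star J).
  by apply: coth_time_gt1 => //; apply: C_M_ge0_tanh => //; rewrite Cm.
have [t0 kt] := coth2_arccoth k1; split=> //; split=> //.
move=> u /andP[mu u1]; rewrite kt; apply: (@coth_time_decr_after _ _ (m_star J)) => //.
by apply/ltW/coth_time_num_lt0_of_C_M; rewrite ?Cm// m0 ltW.
Qed.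

Lemma m_hat_at_Psi_c J : 3 / 2 < J -> m_hat J (Psi_c J) = m_star J.
Proof.
move=> J1; have [t0 lc] := Psi_c_large J1; have [_ Cm] := m_starP J1.
by apply: m_hat_cross => //; [lra|rewrite Cm].
Qed.

Lemma min_cost_ge0_at_Psi_c J : 3 / 2 < J -> forall x, 0 <= x < 1 -> 0 <= min_cost J (Psi_c J) x.
Proof.
move=> J1; have [t0 lc] := Psi_c_large J1; have [_ Cm] := m_starP J1.
by apply: min_cost_ge0_cross lc _ => //; [lra|rewrite Cm].
Qed.

(** The cost is nonnegative at Psi_c and was larger before. *)
Lemma m_hat_before_Psi_c J t : 3 / 2 < J -> 0 < t -> t < Psi_c J -> m_hat J t = 0.
Proof.
move=> J1 t0 tP; apply: m_hat_eq0 => // x x01.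
apply: le_lt_trans (min_cost_decrt J t0 tP x01); apply: min_cost_ge0_at_Psi_c => //.
by case/andP: x01 => /ltW -> ->.
Qed.

Lemma after_Psi_c J t : 3 / 2 < J -> Psi_c J < t ->
  m_star J < m_hat J t /\ last_cross J t (m_hat J t).
Proof.
move=> J1 Pt; have J0 : 0 < J by lra.
have [P0 [m01 km _]] := Psi_c_large J1; have [_ Cm] := m_starP J1.
have /andP[m0 m1] := m01.
have t0 : 0 < t by exact: lt_trans Pt.
have kt : coth2 t < coth_time J (m_star J) by rewrite km; exact: coth2_decr.
have nm : coth_time_num J (m_star J) <= 0.
  by apply/ltW/coth_time_num_lt0_of_C_M; rewrite ?Cm// m0 ltW.
have [m sm lc] := cross_exists J0 t0 m01 kt nm.
suff -> : m_hat J t = m by [].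
have [/andP[_ mlt1] _ _] := lc.
apply: m_hat_cross => //; apply: ltW.
by apply: (@C_M_neg_after _ J (m_star J)); rewrite ?Cm// ltW.
Qed.

Lemma min_cost_ge0_before_Psi_c J t x : 1 < J -> 0 < t -> t <= Psi_c J -> 0 < x < 1 ->
  0 <= min_cost J t x.
Proof.
move=> J1 t0 tP x01; have [J32|J32] := leP J (3 / 2).
- have [P0 kP] := Psi_c_small J1 J32.
  have kt : 2 * J - 1 <= coth2 t.
    by rewrite -kP; move: tP; rewrite le_eqVlt => /orP[/eqP->//|/(coth2_decr t0)/ltW].
  have [h _] := small_no_cross (ltac:(lra) : 0 < J) J32 t0 kt.
  exact/ltW/h.
- have v : 0 <= min_cost J (Psi_c J) x.
    by apply: min_cost_ge0_at_Psi_c => //; case/andP: x01 => /ltW -> ->.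
  move: tP; rewrite le_eqVlt => /orP[/eqP->//|tP].
  exact: le_trans v (ltW (min_cost_decrt J t0 tP x01)).
Qed.

Lemma Psi_c_gt0 J : 1 < J -> 0 < Psi_c J.
Proof.
move=> J1; have [J32|J32] := leP J (3 / 2).
- by have [] := Psi_c_small J1 J32.
- by have [] := Psi_c_large J32.
Qed.

(** It suffices that 0 is not a minimizer for J2 at time Psi_c J1: for J1 <= 3/2
    it has become a local maximum, for J1 > 3/2 the cost of m_star(J1), which is
    0 for J1, is negative for J2. *)
Lemma Psi_c_decreasing J1 J2 : 1 < J1 -> J1 < J2 -> Psi_c J2 < Psi_c J1.
Proof.
move=> J11 J12; have P0 := Psi_c_gt0 J11; have J21 := lt_trans J11 J12.
suff [x x01 vx] : exists2 x, 0 < x < 1 & min_cost J2 (Psi_c J1) x < 0.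
  rewrite ltNge; apply/negP => P12.
  by have := min_cost_ge0_before_Psi_c J21 P0 P12 x01; rewrite leNgt vx.
have [J32|J32] := leP J1 (3 / 2).
- have [_ kP] := Psi_c_small J11 J32.
  have kt : coth2 (Psi_c J1) < 2 * J2 - 1 by rewrite kP; lra.
  by have [x x01 [_ vx]] := min_cost_neg_near0 P0 kt; exists x.
- have [_ [m01 km _]] := Psi_c_large J32; have [_ Cm] := m_starP J32.
  exists (m_star J1) => //.
  apply: lt_le_trans (min_cost_decrJ _ J12 _) _.
    by rewrite gt_eqF//; case/andP: m01.
  by rewrite min_cost_critical ?Cm//; lra.
Qed.

End phases.

(** * Continuity of the half-width of the cone *)

Section continuity.
Context {R : realType}.
Implicit Types (J t m x y : R).

(** The convexity of D replaces comparison points that fall outside D. *)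
Lemma branch_cvg (T : Type) (F : set_system T) (FF : Filter F) (m : T -> R)
    (D : set R) (m0 : R) : D m0 ->
  (forall x y z, D x -> D z -> x <= y <= z -> D y) ->
  (\forall p \near F, D (m p)) ->
  (forall y, D y -> m0 < y -> \forall p \near F, m p < y) ->
  (forall y, D y -> y < m0 -> \forall p \near F, y < m p) ->
  m p @[p --> F] --> m0.
Proof.
move=> D0 conv Dm up lo; apply/cvgrPdist_lt => e e0.
have U : \forall p \near F, m p < m0 + e.
  have [Dy|nD] := pselect (D (m0 + e)); first by apply: up => //; lra.
  apply: filterS Dm => p Dp; rewrite ltNge; apply/negP => h; apply: nD.
  by apply: (conv m0 _ (m p)) => //; rewrite h andbT; lra.
have L : \forall p \near F, m0 - e < m p.
  have [Dy|nD] := pselect (D (m0 - e)); first by apply: lo => //; lra.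
  apply: filterS Dm => p Dp; rewrite ltNge; apply/negP => h; apply: nD.
  by apply: (conv (m p) _ m0) => //; rewrite h/=; lra.
apply: filterS2 U L => p hu hl; rewrite ltr_norml; lra.
Qed.

Lemma last_cross_gt J t m y : last_cross J t m -> 0 < y < 1 -> coth2 t < coth_time J y -> y < m.
Proof.
move=> [/andP[m0 m1] km hm] /andP[y0 y1] ky; rewrite ltNge le_eqVlt; apply/negP => /orP[/eqP e|h].
  by move: ky; rewrite -e km ltxx.
by have := hm y; rewrite h y1 => /(_ isT) /(lt_trans ky); rewrite ltxx.
Qed.

Lemma coth_time_continuousJ y J : coth_time J' y @[J' --> J] --> coth_time J y.
Proof.
have : exists d, is_derive J 1 (fun J' => coth_time J' y) d.
  exists ((2 * y * cosh (2 * y * J) - y * (2 * y * sinh (2 * y * J))) / y).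
  have -> : (fun J' => coth_time J' y) = (fun J' => (sinh (2 * y * J') - y * cosh (2 * y * J')) * y^-1).
    by apply/funext => J'; rewrite /coth_time /a_J; congr ((sinh _ - y * cosh _) / y); ring.
  derive_hyp; ring.
by move=> [d]; exact: derive_continuous.
Qed.

Lemma m_hat_small_itv J t : 0 < J -> J <= 3 / 2 -> 0 < t -> 0 <= m_hat J t < 1.
Proof.
move=> J0 J1 t0; have [kt|kt] := leP (2 * J - 1) (coth2 t).
  by have [_ ->] := small_no_cross J0 J1 t0 kt; rewrite lexx ltr01.
by have [/andP[m0 m1] _ _] := small_cross J0 J1 t0 kt; rewrite ltW.
Qed.

Lemma m_hat_small_upper J t y : 0 < J -> J <= 3 / 2 -> 0 < t -> 0 < y ->
  coth_time J y < coth2 t -> m_hat J t < y.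
Proof.
move=> J0 J1 t0 y0 ky; have [kt|kt] := leP (2 * J - 1) (coth2 t).
  by have [_ ->] := small_no_cross J0 J1 t0 kt.
have [_ km _] := small_cross J0 J1 t0 kt.
rewrite ltNge le_eqVlt; apply/negP => /orP[/eqP e|h].
  by move: ky; rewrite e km ltxx.
by have := coth_time_decr J0 J1 y0 h; rewrite km => /(lt_trans ky); rewrite ltxx.
Qed.

Lemma m_hat_small_lower J t y : 0 < J -> J <= 3 / 2 -> 0 < t -> 0 < y < 1 ->
  coth2 t < coth_time J y -> y < m_hat J t.
Proof.
move=> J0 J1 t0 y01 ky; have y0 : 0 < y by case/andP: y01.
have kt := lt_trans ky (coth_time_lt_limit J0 J1 y0).
exact: last_cross_gt (small_cross J0 J1 t0 kt) y01 ky.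
Qed.

Lemma m_hat_small_continuous J t0 : 0 < J -> J <= 3 / 2 -> 0 < t0 ->
  m_hat J t @[t --> t0] --> m_hat J t0.
Proof.
move=> J0 J1 t00.
have tpos : \forall t \near t0, 0 < t by exact: lt_nbhsr.
have kcv := coth2_continuous t00.
apply: (@branch_cvg _ _ _ _ [set x | 0 <= x < 1]).
- exact: m_hat_small_itv.
- by move=> x y z /= /andP[x0 x1] /andP[z0 z1] /andP[xy yz]; rewrite (le_trans x0)// (le_lt_trans yz).
- by apply: filterS tpos => t; exact: m_hat_small_itv.
- move=> y /= /andP[y0 y1] my.
  have yp : 0 < y by apply: le_lt_trans my; case/andP: (m_hat_small_itv J0 J1 t00).
  have ky : coth_time J y < coth2 t0.
    have [kt|kt] := leP (2 * J - 1) (coth2 t0).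
      exact: lt_le_trans (coth_time_lt_limit J0 J1 yp) kt.
    by have [_ _ hm] := small_cross J0 J1 t00 kt; apply: hm; rewrite my.
  apply: filterS2 tpos (cvgr_gt _ kcv _ ky) => t t0' kt.
  exact: m_hat_small_upper.
- move=> y /= /andP[y0 y1] ym.
  have kt : coth2 t0 < 2 * J - 1.
    rewrite ltNge; apply/negP => kt.
    by have [_ h] := small_no_cross J0 J1 t00 kt; move: ym; rewrite h ltNge y0.
  have [/andP[m0 m1] km _] := small_cross J0 J1 t00 kt.
  (* y may be 0, where a^J(y) / y is not the limit. *)
  pose w := (y + m_hat J t0) / 2.
  have yw : y < w by rewrite /w; lra.
  have wm : w < m_hat J t0 by rewrite /w; lra.
  have w0 : 0 < w by rewrite (le_lt_trans y0).
  have kw : coth2 t0 < coth_time J w by rewrite -km; exact: coth_time_decr.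
  apply: filterS2 tpos (cvgr_lt _ kcv _ kw) => t t0' ktw.
  apply: lt_trans yw _; apply: m_hat_small_lower => //.
  by rewrite w0 (lt_trans wm).
Qed.

Lemma m_hat_left_continuous_critical t : Psi_c (3 / 2 : R) < t ->
  m_hat J t @[J --> (3 / 2 : R)^'-] --> m_hat (3 / 2) t.
Proof.
have [P0 kP] := @Psi_c_small R (3 / 2) ltac:(lra) (lexx _).
move=> Pt; have t0 := lt_trans P0 Pt.
have kt : coth2 t < 2 * (3 / 2) - 1 by rewrite -kP; exact: coth2_decr.
have h32 : 0 < 3 / 2 :> R by lra.
have lc := small_cross h32 (lexx _) t0 kt.
have [m01 km hm] := lc; have /andP[m0 m1] := m01.
have Jlt : \forall J \near (3 / 2 : R)^'-, J < 3 / 2 by exact: nbhs_left_lt.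
have Jgt : \forall J \near (3 / 2 : R)^'-, (coth2 t + 1) / 2 < J.
  by apply: nbhs_left_gt; lra.
have k1 := coth2_gt1 t0.
have Jok : \forall J \near (3 / 2 : R)^'-, [/\ 0 < J, J < 3 / 2 & coth2 t < 2 * J - 1].
  by apply: filterS2 Jlt Jgt => J h1 h2; split=> //; lra.
apply: (@branch_cvg _ _ _ _ [set x | 0 < x < 1]).
- exact: m01.
- by move=> x y z /= /andP[x0 x1] /andP[z0 z1] /andP[xy yz]; rewrite (lt_le_trans x0)// (le_lt_trans yz).
- apply: filterS Jok => J [J0 J1 kJ].
  by have [] := small_cross J0 (ltW J1) t0 kJ.
- move=> y /= /andP[y0 y1] my.
  apply: filterS Jok => J [J0 J1 kJ].
  apply: m_hat_small_upper => //; first exact: ltW.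
  apply: (@lt_trans _ _ (coth_time (3 / 2) y)); first by apply: coth_time_incrJ => //; rewrite y0.
  by apply: hm; rewrite my.
- move=> y /= /andP[y0 y1] ym.
  have ky : coth2 t < coth_time (3 / 2) y by rewrite -km; exact: coth_time_decr.
  have cv : coth_time J y @[J --> (3 / 2 : R)^'-] --> coth_time (3 / 2) y.
    by apply: cvg_at_left_filter; exact: coth_time_continuousJ.
  apply: filterS2 Jok (cvgr_gt _ cv _ ky) => J [J0 J1 kJ] kJy.
  by apply: m_hat_small_lower => //; [exact: ltW|rewrite y0].
Qed.

(** For J > Jb the half-width exceeds m_star(J) > m_star(Jb), so only upper
    bounds are at stake. They follow from unimodality: a^J(m) / m is above coth
    2t at m_star(Jb) and below it at y, hence below it from y on. *)
Lemma m_hat_right_continuous_J (Jb : R) : 3 / 2 < Jb ->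
  m_hat J (Psi_c Jb) @[J --> Jb^'+] --> m_hat Jb (Psi_c Jb).
Proof.
move=> J1; have [P0 lc] := Psi_c_large J1.
rewrite m_hat_at_Psi_c//; have [m01 km hm] := lc; have /andP[m0 m1] := m01.
have Jgt : \forall J \near Jb^'+, Jb < J by exact: nbhs_right_gt.
have after J : Jb < J -> m_star Jb < m_hat J (Psi_c Jb) /\
    last_cross J (Psi_c Jb) (m_hat J (Psi_c Jb)).
  move=> JbJ; have J2 := lt_trans J1 JbJ.
  (* At the time Psi_c Jb the larger J is already past its critical time. *)
  have Pd := @Psi_c_decreasing R Jb J ltac:(lra) JbJ.
  have [h1 h2] := after_Psi_c J2 Pd; split=> //.
  exact: lt_trans (m_star_increasing J1 JbJ) h1.
apply: (@branch_cvg _ _ _ _ [set x | m_star Jb <= x < 1]).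
- by rewrite /= lexx.
- by move=> x y z /= /andP[x0 x1] /andP[z0 z1] /andP[xy yz]; rewrite (le_trans x0)// (le_lt_trans yz).
- apply: filterS Jgt => J /after[h [/andP[_ h1] _ _]].
  by rewrite /= (ltW h).
- move=> y /= /andP[_ y1] my.
  have ky : coth_time Jb y < coth2 (Psi_c Jb) by apply: hm; rewrite my.
  have cv : coth_time J y @[J --> Jb^'+] --> coth_time Jb y.
    by apply: cvg_at_right_filter; exact: coth_time_continuousJ.
  apply: filterS2 Jgt (cvgr_lt _ cv _ ky) => J JbJ kJy.
  have [h [_ kmJ _]] := after J JbJ.
  have kJm : coth2 (Psi_c Jb) < coth_time J (m_star Jb) by rewrite -km; exact: coth_time_incrJ.
  rewrite ltNge le_eqVlt; apply/negP => /orP[/eqP e|h2].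
    by move: kJy; rewrite e kmJ ltxx.
  have := @coth_time_unimodal _ J _ _ _ ltac:(lra) m0 my (ltW (lt_trans kJy kJm)) h2.
  by rewrite kmJ => /lt_trans/(_ kJy); rewrite ltxx.
- by move=> y /= /andP[y0 _]; rewrite ltNge y0.
Qed.

(** The filter is arbitrary in order to cover both the times after Psi_c and the
    right limit at Psi_c. *)
Lemma m_hat_large_continuous J t0 (F : set_system R) (FF : Filter F) : 3 / 2 < J ->
  Psi_c J <= t0 -> t @[t --> F] --> t0 -> (\forall t \near F, Psi_c J < t) ->
  m_hat J t @[t --> F] --> m_hat J t0.
Proof.
move=> J1 Pt tcv Ft; have J0 : 0 < J by lra.
have [P0 lcP] := Psi_c_large J1; have [/andP[s0 s1] Cs] := m_starP J1.
have t00 : 0 < t0 by exact: lt_le_trans Pt.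
have nm : coth_time_num J (m_star J) <= 0.
  by apply/ltW/coth_time_num_lt0_of_C_M; rewrite ?Cs// s0 ltW.
have [sm lc] : m_star J <= m_hat J t0 /\ last_cross J t0 (m_hat J t0).
  move: Pt; rewrite le_eqVlt => /orP[/eqP<-|/(after_Psi_c J1)[/ltW//]].
  by rewrite m_hat_at_Psi_c.
have [/andP[m0 m1] km hm] := lc.
have kcv : coth2 t @[t --> F] --> coth2 t0.
  by apply: (cvg_comp _ _ tcv); exact: coth2_continuous.
apply: (@branch_cvg _ _ _ _ [set x | m_star J <= x < 1]).
- by rewrite /= sm.
- by move=> x y z /= /andP[x0 x1] /andP[z0 z1] /andP[xy yz]; rewrite (le_trans x0)// (le_lt_trans yz).
- apply: filterS Ft => t /(after_Psi_c J1)[h [/andP[_ h1] _ _]].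
  by rewrite /= (ltW h).
- move=> y /= /andP[sy y1] my.
  have ky : coth_time J y < coth2 t0 by apply: hm; rewrite my.
  apply: filterS2 Ft (cvgr_gt _ kcv _ ky) => t /(after_Psi_c J1)[_ [_ kmt _]] kty.
  rewrite ltNge le_eqVlt; apply/negP => /orP[/eqP e|h2].
    by move: kty; rewrite e kmt ltxx.
  have := coth_time_decr_after J0 s0 nm sy h2.
  by rewrite kmt => /(lt_trans kty); rewrite ltxx.
- move=> y /= /andP[sy y1] ym.
  have ky : coth2 t0 < coth_time J y by rewrite -km; exact: coth_time_decr_after s0 nm sy ym.
  apply: filterS2 Ft (cvgr_lt _ kcv _ ky) => t /(after_Psi_c J1)[_ lct] kty.
  by apply: last_cross_gt lct _ kty; rewrite y1 (lt_le_trans s0).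
Qed.

Lemma m_hat_large_ge0 J t : 3 / 2 < J -> 0 < t -> 0 <= m_hat J t.
Proof.
move=> J1 t0; have [/andP[s0 _] _] := m_starP J1.
case: (ltgtP t (Psi_c J)) => [tP|Pt|->].
- by rewrite m_hat_before_Psi_c.
- have [h _] := after_Psi_c J1 Pt; exact/ltW/(lt_trans s0).
- by rewrite m_hat_at_Psi_c// ltW.
Qed.

Lemma coneE J t : cone J t = cone_of (m_hat J t) t.
Proof. by []. Qed.

End continuity.

Theorem theorem3 (R : realType) :
  (* (i) *)
  (forall J1 J2 : R, 3 / 2 < J1 -> J1 < J2 -> m_star J1 < m_star J2) /\
  (* (ii) *)
  (forall J1 J2 : R, 1 < J1 -> J1 < J2 -> Psi_c J2 < Psi_c J1) /\
  (* (iii) *)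
  (forall t : R, Psi_c (3 / 2 : R) < t ->
     hausdorff_dist (cone J t) (cone (3 / 2) t) @[J --> (3 / 2 : R)^'-] --> (0 : R)) /\
  (* (iv) *)
  (forall Jbar : R, 3 / 2 < Jbar ->
     hausdorff_dist (cone J (Psi_c Jbar)) (cone Jbar (Psi_c Jbar))
       @[J --> Jbar^'+] --> (0 : R)) /\
  (* (v) *)
  (forall J t0 : R, 0 < J -> J <= 3 / 2 -> 0 < t0 ->
     hausdorff_dist (cone J t) (cone J t0) @[t --> t0] --> (0 : R)) /\
  (* (vi) *)
  (forall J : R, 3 / 2 < J ->
     (forall t0 : R, 0 < t0 -> t0 <> Psi_c J ->
        hausdorff_dist (cone J t) (cone J t0) @[t --> t0] --> (0 : R)) /\
     hausdorff_dist (cone J t) (cone J (Psi_c J)) @[t --> (Psi_c J)^'+] --> (0 : R) /\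
     (exists K : set (R * R),
        [/\ K !=set0, compact K, K <> cone J (Psi_c J) &
            hausdorff_dist (cone J t) K @[t --> (Psi_c J)^'-] --> (0 : R)])).
Proof.
split; first by move=> J1 J2; exact: m_star_increasing.
split; first by move=> J1 J2; exact: Psi_c_decreasing.
have h32 : 0 < 3 / 2 :> R by lra.
split.
  move=> t Pt; have t0 : 0 < t by apply: lt_trans Pt; apply: Psi_c_gt0; lra.
  apply: (@hausdorff_cone_cvg _ _ _ _ (fun J => m_hat J t) (fun=> t)) => //.
  - by have /andP[] := m_hat_small_itv h32 (lexx _) t0.
  - near=> J.
    have J0 : 0 < J by near: J; apply: nbhs_left_gt.
    have J1 : J < 3 / 2 by near: J; exact: nbhs_left_lt.
    by have /andP[] := m_hat_small_itv J0 (ltW J1) t0.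
  - exact: cvg_cst.
  - exact: m_hat_left_continuous_critical.
split.
  move=> Jb J1; have P0 : 0 < Psi_c Jb by apply: Psi_c_gt0; lra.
  apply: (@hausdorff_cone_cvg _ _ _ _ (fun J => m_hat J (Psi_c Jb)) (fun=> Psi_c Jb)) => //.
  - exact: m_hat_large_ge0.
  - near=> J; apply: m_hat_large_ge0 => //; apply: lt_trans J1 _.
    by near: J; exact: nbhs_right_gt.
  - exact: cvg_cst.
  - exact: m_hat_right_continuous_J.
split.
  move=> J t0 J0 J1 t00.
  apply: (@hausdorff_cone_cvg _ _ (nbhs t0) _ (m_hat J) id) => //.
  - by have /andP[] := m_hat_small_itv J0 J1 t00.
  - near=> t; have t1 : 0 < t by near: t; exact: lt_nbhsr.
    by have /andP[] := m_hat_small_itv J0 J1 t1.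
  - exact: m_hat_small_continuous.
move=> J J1; have P0 : 0 < Psi_c J by apply: Psi_c_gt0; lra.
split; [|split].
- move=> t0 t00 t0P.
  apply: (@hausdorff_cone_cvg _ _ (nbhs t0) _ (m_hat J) id) => //.
  + exact: m_hat_large_ge0.
  + near=> t; apply: m_hat_large_ge0 => //.
    by near: t; exact: lt_nbhsr.
  + case: (ltgtP t0 (Psi_c J)) t0P => // [tP|Pt] _.
      rewrite m_hat_before_Psi_c//; apply: cvg_near_cst; near=> t.
      apply: (m_hat_before_Psi_c J1).
        by near: t; exact: lt_nbhsr.
      by near: t; exact: lt_nbhsl.
    apply: m_hat_large_continuous => //; first exact: ltW.
    exact: lt_nbhsr.
- apply: (@hausdorff_cone_cvg _ _ _ _ (m_hat J) id) => //.
  + exact: m_hat_large_ge0.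
  + near=> t; apply: m_hat_large_ge0 => //; apply: lt_trans P0 _.
    by near: t; exact: nbhs_right_gt.
  + by apply: cvg_at_right_filter; exact: cvg_id.
  + apply: m_hat_large_continuous => //.
      by apply: cvg_at_right_filter; exact: cvg_id.
    exact: nbhs_right_gt.
- exists (cone_of 0 (Psi_c J)); split.
  + by apply: cone_of_neq0 => //; exact: ltW.
  + exact: cone_of0_compact.
  + rewrite coneE m_hat_at_Psi_c// => e.
    have [/andP[s0 _] _] := m_starP J1.
    have : cone_of 0 (Psi_c J) (0, m_star J).
      rewrite e; split=> /=; first by rewrite lexx ltW.
      by rewrite subr0 divff ?mulr1 ?ger0_norm// ?ltW// gt_eqF// sinh2t_gt0.
    by move=> [_ /=]; rewrite mul0r normr_le0 gt_eqF.
  + apply: (@hausdorff_cone_cvg _ _ _ _ (m_hat J) id) => //.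
    * near=> t; apply: (m_hat_large_ge0 J1).
      by near: t; exact: nbhs_left_gt.
    * by apply: cvg_at_left_filter; exact: cvg_id.
    * apply: cvg_near_cst; near=> t.
      apply: (m_hat_before_Psi_c J1).
        by near: t; exact: nbhs_left_gt.
      by near: t; exact: nbhs_left_lt.
Unshelve. all: by end_near. Qed.
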